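(* The dynamic program that computes the values $E_k(\vec a,\vec b,w,e)$ through the recurrence $E_0(\vec a,\vec b,0,e)=0$, $E_0(\vec a,\vec b,w,e)=+\infty$ for $w\neq 0$, and $E_k(\vec a,\vec b,w,e)=\min\{E_{k-1}(\vec a,\vec b,w,e),E'\}$ with $E'$ as in the context, and returns $\max\{w: E_n((r_{\min},\dots,r_{\min}),(d_n,\dots,d_n),w,r_{\min})\le E\}$, has running time $O(n^{12m+7}W^2)$.
   Context: Setting: a fixed number $m$ of identical speed-scalable machines; $n$ jobs, job $j$ with integer release date $r_j$, integer deadline $d_j$, integer weight $w_j$ and common processing volume $p$; jobs indexed so that $d_1\le\dots\le d_n$; $r_{\min}:=\min_jr_j$; $W:=\sum_jw_j$; energy budget $E$. Schedules are non-preemptive and non-migratory; power $P(z)=z^\alpha$, $\alpha>1$. $\Omega:=\{r_j\}\cup\{d_j\}$; $\Theta_{a,b}:=\{a+\ell\frac{b-a}{k}:k=1..n,\ \ell=0..k\}$ for $a\le b$, $\Theta:=\bigcup_{a,b\in\Omega}\Theta_{a,b}$; $\Lambda:=\{\frac{\ell p}{b-a}:\ell=1..n,\ a,b\in\Omega,\ a<b\}$; $J(k,a,b):=\{j:j\le k,\ a\le r_j<b\}$. Time vectors $\vec a\in\mathbb{R}_+^m$, with $\vec a\preceq\vec b$ iff $a_i\le b_i\ \forall i$, $\vec a\prec\vec b$ iff additionally $\vec a\ne\vec b$, $a_{\min}:=\min_ia_i$. $E_k(\vec a,\vec b,w,e)$ ($0\le w\le W$) is the minimum energy of a non-preemptive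 non-migratory schedule whose job set $S\subset J(k,a_{\min},b_{\min})$ has $\sum_{j\in S}w_j\ge w$, with every job of $S$ on machine $i$ processed within $[a_i,b_i]$, $\vec a\preceq\vec b$, some machine $h$ idle during $[a_h,e]$, and for all machines $i\ne i'$, $b_{i'}$ at least the last starting time of a job on machine $i$ ($\infty$ if none exists). $E'$ is the minimum, over $\vec u\in\Theta^m$ with $\vec a\preceq\vec u\prec\vec b$, $s\in\Lambda$, $1\le h\le m$, $e'=u_h+p/s$ with $r_k\le u_h<e'\le d_k$, and $0\le w'\le w-w_k$, of $E_{k-1}(\vec a,\vec u,w',e)+\frac{p^\alpha}{(e'-u_h)^{\alpha-1}}+E_{k-1}(\vec u,\vec b,w-w'-w_k,e')$. *)

(* Defs.v *)
From Stdlib Require String.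
From HB Require Import structures.
From mathcomp Require Import all_boot all_order all_algebra.
From mathcomp Require Import all_classical all_reals all_analysis.

Set Implicit Arguments.
Unset Strict Implicit.
Unset Printing Implicit Defensive.

Import Order.TTheory GRing.Theory Num.Theory.

Local Open Scope ring_scope.

(** * Instances and the recurrence *)

(* The job called k (counting from 1) in the mathematics is stored at
   position k.-1 of the three tuples.  Weights are nonnegative integers. *)
Record instance (R : realType) (n : nat) := Instance {
  release  : n.-tuple int;
  deadline : n.-tuple int;
  weight   : n.-tuple nat;
  volume   : R;
  alpha    : R;
  budget   : R }.

(* The condition 0 < W only excludes the case where all weights vanish, for
   which a bound proportional to W ^ 2 would be 0. *)
Definition valid (R : realType) (n : nat) (I : instance R n) : Prop :=
  [/\ (0 < n)%N /\ (0 < sumn (weight I))%N,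
      sorted <=%O (deadline I),
      0 < volume I,
      1 < alpha I
    & 0 <= budget I].

Section Recurrence.
Context (R : realType) (n : nat) (I : instance R n).

Definition rel (k : nat) : R := (nth 0 (release I) k)%:~R.
Definition dl (k : nat) : R := (nth 0 (deadline I) k)%:~R.
Definition wt (k : nat) : nat := nth 0%N (weight I) k.

Definition total_weight : nat := sumn (weight I).

Definition rmin : R :=
  (\big[Num.min/nth 0 (release I) 0]_(x <- release I) x)%:~R.

Definition dlast : R := dl n.-1.

Definition Omega : set R :=
  [set x | exists2 j : nat, (j < n)%N & x = rel j \/ x = dl j].

Definition Theta_ab (a b : R) : set R :=
  [set x | exists k l : nat,
     [/\ (1 <= k <= n)%N, (l <= k)%N & x = a + l%:R * ((b - a) / k%:R)]].

Definition Theta : set R :=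
  [set x | exists a b : R, [/\ Omega a, Omega b, a <= b & Theta_ab a b x]].

Definition Lambda : set R :=
  [set x | exists (l : nat) (a b : R),
     [/\ (1 <= l <= n)%N, Omega a, Omega b, a < b
       & x = l%:R * volume I / (b - a)]].

Definition vle (m : nat) (a b : 'rV[R]_m) : Prop :=
  forall i, a 0 i <= b 0 i.

Definition vlt (m : nat) (a b : 'rV[R]_m) : Prop := vle a b /\ a <> b.

Definition in_Theta (m : nat) (u : 'rV[R]_m) : Prop :=
  forall i, Theta (u 0 i).

(* [dpE k a b w e] is the value that the recurrence assigns to
   E_k(a, b, w, e).  The infimum ranges over finitely many values, hence it is
   the minimum E', and it is +oo when there is no admissible choice. *)
Fixpoint dpE (m : nat) (k : nat) (a b : 'rV[R]_m) (w : nat) (e : R) : \bar R :=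
  match k with
  | 0 => if w == 0%N then 0%E else +oo%E
  | k'.+1 =>
    mine (dpE k' a b w e)
      (ereal_inf [set x | exists (u : 'rV[R]_m) (s : R) (h : 'I_m) (w' : nat),
        let e' := u 0 h + volume I / s in
        [/\ in_Theta u /\ Lambda s,
            vle a u /\ vlt u b,
            rel k' <= u 0 h /\ u 0 h < e' <= dl k',
            (w' + wt k' <= w)%N
          & x = (dpE k' a u w' e
                 + (volume I `^ alpha I / (e' - u 0 h) `^ (alpha I - 1))%:E
                 + dpE k' u b (w - w' - wt k') e')%E]])
  end.

Definition is_best_weight (m : nat) (x : nat) : Prop :=
  let feasible w :=
    (w <= total_weight)%N /\
    (dpE n (const_mx rmin : 'rV_m) (const_mx dlast) w rmin <= (budget I)%:E)%E
  in feasible x /\ forall w, feasible w -> (w <= x)%N.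

End Recurrence.

(** * A unit-cost real RAM with multidimensional arrays *)

(* Every memory cell is addressed by an array name and a list of indices; a
   scalar variable is an array with the empty list of indices.  There are
   separate memories for natural numbers and for (extended) real numbers. *)
Definition var : Type := String.string.

Inductive nexp : Type :=
  | NConst of nat
  | NGet of var & seq nexp
  | NAdd of nexp & nexp
  | NSub of nexp & nexp   (* truncated *)
  | NMul of nexp & nexp
  | NDiv of nexp & nexp
  | NMod of nexp & nexp.

Inductive rexp : Type :=
  | RInf
  | ROfNat of nexp
  | RGet of var & seq nexp
  | RAdd of rexp & rexp
  | RSub of rexp & rexp
  | RMul of rexp & rexp
  | RDiv of rexp & rexp
  | RPow of rexp & rexp.

Inductive bexp : Type :=
  | BNEq of nexp & nexp
  | BRLe of rexp & rexp
  | BRLt of rexp & rexp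
  | BAnd of bexp & bexp
  | BNot of bexp.

(* [For i e c] evaluates e once, to N say, and runs c for i = 0, ..., N - 1. *)
Inductive com : Type :=
  | Skip
  | NSet of var & seq nexp & nexp
  | RSet of var & seq nexp & rexp
  | Seq of com & com
  | If of bexp & com & com
  | For of var & nexp & com.

(* The cost of an expression is its number of nodes: each operation,
   comparison and memory access costs 1, and computing the indices of an
   access is charged as well. *)
Fixpoint ncost (e : nexp) : nat :=
  match e with
  | NConst _ => 1
  | NGet _ js => (sumn (map ncost js)).+1
  | NAdd e1 e2 | NSub e1 e2 | NMul e1 e2 | NDiv e1 e2 | NMod e1 e2 =>
      (ncost e1 + ncost e2).+1
  end.

Fixpoint rcost (e : rexp) : nat :=
  match e with
  | RInf => 1
  | ROfNat e1 => (ncost e1).+1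
  | RGet _ js => (sumn (map ncost js)).+1
  | RAdd e1 e2 | RSub e1 e2 | RMul e1 e2 | RDiv e1 e2 | RPow e1 e2 =>
      (rcost e1 + rcost e2).+1
  end.

Fixpoint bcost (b : bexp) : nat :=
  match b with
  | BNEq e1 e2 => (ncost e1 + ncost e2).+1
  | BRLe e1 e2 | BRLt e1 e2 => (rcost e1 + rcost e2).+1
  | BAnd b1 b2 => (bcost b1 + bcost b2).+1
  | BNot b1 => (bcost b1).+1
  end.

Section Semantics.
Context (R : realType).

Record store := Store {
  nmem : var -> seq nat -> nat;
  rmem : var -> seq nat -> \bar R }.

Definition upd (A : Type) (f : var -> seq nat -> A) (x : var) (js : seq nat)
    (v : A) : var -> seq nat -> A :=
  fun y ks => if String.eqb y x && (ks == js) then v else f y ks.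

Definition nput (s : store) (x : var) (js : seq nat) (v : nat) : store :=
  Store (upd (nmem s) x js v) (rmem s).

Definition rput (s : store) (x : var) (js : seq nat) (v : \bar R) : store :=
  Store (nmem s) (upd (rmem s) x js v).

Fixpoint neval (s : store) (e : nexp) : nat :=
  match e with
  | NConst c => c
  | NGet x js => nmem s x (map (neval s) js)
  | NAdd e1 e2 => neval s e1 + neval s e2
  | NSub e1 e2 => neval s e1 - neval s e2
  | NMul e1 e2 => neval s e1 * neval s e2
  | NDiv e1 e2 => neval s e1 %/ neval s e2
  | NMod e1 e2 => neval s e1 %% neval s e2
  end%N.

(* Operations other than addition are only meant for finite operands. *)
Definition on_finite (f : R -> R -> R) (x y : \bar R) : \bar R :=
  (f (fine x) (fine y))%:E.

Fixpoint reval (s : store) (e : rexp) : \bar R :=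
  match e with
  | RInf => +oo%E
  | ROfNat e1 => (neval s e1)%:R%:E
  | RGet x js => rmem s x (map (neval s) js)
  | RAdd e1 e2 => (reval s e1 + reval s e2)%E
  | RSub e1 e2 => on_finite (fun x y => x - y) (reval s e1) (reval s e2)
  | RMul e1 e2 => on_finite (fun x y => x * y) (reval s e1) (reval s e2)
  | RDiv e1 e2 => on_finite (fun x y => x / y) (reval s e1) (reval s e2)
  | RPow e1 e2 => on_finite (fun x y => x `^ y) (reval s e1) (reval s e2)
  end.

Fixpoint beval (s : store) (b : bexp) : bool :=
  match b with
  | BNEq e1 e2 => neval s e1 == neval s e2
  | BRLe e1 e2 => (reval s e1 <= reval s e2)%E
  | BRLt e1 e2 => (reval s e1 < reval s e2)%E
  | BAnd b1 b2 => beval s b1 && beval s b2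
  | BNot b1 => ~~ beval s b1
  end.

(* [run c s] is the final store together with the running time. *)
Fixpoint run (c : com) (s : store) : store * nat :=
  match c with
  | Skip => (s, 1)
  | NSet x js e =>
      (nput s x (map (neval s) js) (neval s e),
       (sumn (map ncost js) + ncost e).+1)
  | RSet x js e =>
      (rput s x (map (neval s) js) (reval s e),
       (sumn (map ncost js) + rcost e).+1)
  | Seq c1 c2 =>
      let: (s1, t1) := run c1 s in
      let: (s2, t2) := run c2 s1 in
      (s2, t1 + t2)
  | If b c1 c2 =>
      let: (s', t) := run (if beval s b then c1 else c2) s in
      (s', (bcost b + t).+1)
  | For i e c =>
      foldl (fun st j =>
               let: (s', t) := run c (nput st.1 i [::] j) in
               (s', (st.2 + t).+1))
            (s, (ncost e).+1) (iota 0 (neval s e))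
  end%N.

End Semantics.

(** * The dynamic program *)

Declare Scope ram_scope.
Delimit Scope ram_scope with ram.

Module RamNotations.
Export String.StringSyntax.

Definition nscalar (x : String.string) : nexp := NGet x [::].
Coercion NConst : nat >-> nexp.
Coercion nscalar : String.string >-> nexp.
Coercion ROfNat : nexp >-> rexp.

Notation "[# i ; .. ; j ]" :=
  (@cons nexp i .. (@cons nexp j (@nil nexp)) ..) : ram_scope.
Infix "+n" := NAdd (at level 50, left associativity) : ram_scope.
Infix "-n" := NSub (at level 50, left associativity) : ram_scope.
Infix "*n" := NMul (at level 40, left associativity) : ram_scope.
Infix "/n" := NDiv (at level 40, left associativity) : ram_scope.
Infix "%n" := NMod (at level 40, left associativity) : ram_scope.
Notation "x =n y" := (BNEq x y) (at level 70, no associativity) : ram_scope.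
Infix "+r" := RAdd (at level 50, left associativity) : ram_scope.
Infix "-r" := RSub (at level 50, left associativity) : ram_scope.
Infix "*r" := RMul (at level 40, left associativity) : ram_scope.
Infix "/r" := RDiv (at level 40, left associativity) : ram_scope.
Infix "^r" := RPow (at level 30, right associativity) : ram_scope.
Notation "x <=r y" := (BRLe x y) (at level 70, no associativity) : ram_scope.
Notation "x <r y" := (BRLt x y) (at level 70, no associativity) : ram_scope.
Infix "&b" := BAnd (at level 75, right associativity) : ram_scope.
Notation "c1 ;; c2" := (Seq c1 c2) (at level 90, right associativity)
  : ram_scope.
End RamNotations.

Section Program.
Import RamNotations.
Local Open Scope string_scope.
Local Open Scope nat_scope.
Local Open Scope ram_scope.

(* The n jobs give 2n points of Omega, listed with repetitions. *)
Definition compute_Omega : com :=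
  For "j" "n" (
    RSet "Omega" [# "j"] (RGet "r" [# "j"]) ;;
    RSet "Omega" [# "n" +n "j"] (RGet "d" [# "j"])).

(* The two lists may contain repetitions; their lengths are N and L. *)
Definition compute_Theta : com :=
  let a := RGet "Omega" [# "i"] in
  let b := RGet "Omega" [# "j"] in
  NSet "N" [::] 0 ;;
  For "i" (2 *n "n") (For "j" (2 *n "n") (
    If (a <=r b)
      (For "k" "n" (For "l" ("k" +n 2) (
         RSet "Theta" [# "N"]
           (a +r "l" *r ((b -r a) /r ("k" +n 1))) ;;
         NSet "N" [::] ("N" +n 1))))
      Skip)).

Definition compute_Lambda : com :=
  let a := RGet "Omega" [# "i"] in
  let b := RGet "Omega" [# "j"] in
  NSet "L" [::] 0 ;;
  For "i" (2 *n "n") (For "j" (2 *n "n") (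
    If (a <r b)
      (For "l" "n" (
         RSet "Lambda" [# "L"]
           (("l" +n 1) *r RGet "p" [::] /r (b -r a)) ;;
         NSet "L" [::] ("L" +n 1)))
      Skip)).

(* A time e is represented, relatively to a vector a, by a machine h and an
   index s such that e = a_h + shift[s], where shift[s] = p / Lambda[s] for
   s < L.  The extra entry shift[L] = 0 serves for the initial state, in which
   e = r_min. *)
Definition compute_shift : com :=
  For "s" "L" (
    RSet "shift" [# "s"]
      (RGet "p" [::] /r RGet "Lambda" [# "s"])) ;;
  RSet "shift" [# "L"] 0.

(* The M = N ^ m vectors over Theta are numbered by writing their numbers in
   base N; vec[c, i] is the i-th coordinate of the vector number c. *)
Definition compute_vectors (m : nat) : com :=
  NSet "M" [::] 1 ;;
  For "i" m (
    NSet "base" [# "i"] "M" ;;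
    NSet "M" [::] ("M" *n "N")) ;;
  For "c" "M" (For "i" m (
    RSet "vec" [# "c"; "i"]
      (RGet "Theta" [# "c" /n NGet "base" [# "i"] %n "N"]))).

Definition compute_weight : com :=
  NSet "W" [::] 0 ;;
  For "j" "n" (NSet "W" [::] ("W" +n NGet "w" [# "j"])).

Definition compute_rmin : com :=
  RSet "rmin" [::] (RGet "r" [# 0]) ;;
  For "j" "n" (
    If (RGet "r" [# "j"] <r RGet "rmin" [::])
      (RSet "rmin" [::] (RGet "r" [# "j"]))
      Skip).

(* Stores in x the number of a vector all of whose coordinates equal v. *)
Definition find_constant (m : nat) (x : var) (v : rexp) : com :=
  For "c" "M" (
    NSet "ok" [::] 1 ;;
    For "i" m (
      let y := RGet "vec" [# "c"; "i"] in
      If (y <=r v &b v <=r y) Skip (NSet "ok" [::] 0)) ;;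
    If ("ok" =n 1) (NSet x [::] "c") Skip).

(* Sets ok and strict to 1 exactly when the vector number u is between those
   numbered a and b, respectively different from the one numbered b. *)
Definition compare_vectors (m : nat) : com :=
  let va := RGet "vec" [# "a"; "i"] in
  let vb := RGet "vec" [# "b"; "i"] in
  let vu := RGet "vec" [# "u"; "i"] in
  NSet "ok" [::] 1 ;;
  NSet "strict" [::] 0 ;;
  For "i" m (
    If (va <=r vu &b vu <=r vb) Skip (NSet "ok" [::] 0) ;;
    If (vu <=r vb &b vb <=r vu) Skip (NSet "strict" [::] 1)).

(* Runs c for all vectors a, b, weights w <= W and representations (h, s) of
   a time e. *)
Definition for_states (m : nat) (c : com) : com :=
  For "a" "M" (For "b" "M" (For "wgt" ("W" +n 1)
    (For "h" m (For "s" ("L" +n 1) c)))).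

Definition cell (k a b w h s : nexp) : seq nexp := [:: k; a; b; w; h; s].

Definition fill_first (m : nat) : com :=
  for_states m (
    If ("wgt" =n 0)
      (RSet "E" (cell 0 "a" "b" "wgt" "h" "s") 0)
      (RSet "E" (cell 0 "a" "b" "wgt" "h" "s") RInf)).

Definition fill_next (m : nat) : com :=
  let uh := RGet "vec" [# "u"; "h'"] in
  let e' := RGet "e'" [::] in
  let wk := NGet "w" [# "k"] in
  let best := RGet "best" [::] in
  let cand := RGet "cand" [::] in
  let alpha := RGet "alpha" [::] in
  for_states m (
    RSet "best" [::] (RGet "E" (cell "k" "a" "b" "wgt" "h" "s")) ;;
    For "u" "M" (
      compare_vectors m ;;
      If ("ok" =n 1 &b "strict" =n 1)
        (For "s'" "L" (For "h'" m (
           RSet "e'" [::]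
             (uh +r RGet "p" [::] /r RGet "Lambda" [# "s'"]) ;;
           If (RGet "r" [# "k"] <=r uh
               &b uh <r e'
               &b e' <=r RGet "d" [# "k"])
             (For "w'" ("wgt" +n 1 -n wk) (
                RSet "cand" [::]
                  (RGet "E" (cell "k" "a" "u" "w'" "h" "s")
                   +r (RGet "p" [::] ^r alpha)
                      /r ((e' -r uh) ^r (alpha -r 1))
                   +r RGet "E" (cell "k" "u" "b" ("wgt" -n "w'" -n wk)
                                  "h'" "s'")) ;;
                If (cand <r best) (RSet "best" [::] cand) Skip))
             Skip)))
        Skip) ;;
    RSet "E" (cell ("k" +n 1) "a" "b" "wgt" "h" "s") best).

Definition select_answer : com :=
  For "wgt" ("W" +n 1) (
    If (RGet "E" (cell "n" "start" "end" "wgt" 0 "L") <=r RGet "budget" [::])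
      (NSet "answer" [::] "wgt")
      Skip).

(* The number m of machines is fixed: there is one program for each m. *)
Definition dp (m : nat) : com :=
  compute_Omega ;;
  compute_Theta ;;
  compute_Lambda ;;
  compute_shift ;;
  compute_vectors m ;;
  compute_weight ;;
  compute_rmin ;;
  find_constant m "start" (RGet "rmin" [::]) ;;
  find_constant m "end" (RGet "d" [# "n" -n 1]) ;;
  fill_first m ;;
  For "k" "n" (fill_next m) ;;
  select_answer.

End Program.

Section InputOutput.
Context (R : realType).
Import RamNotations.
Local Open Scope string_scope.

(* The input: all other memory cells initially contain 0. *)
Definition load (n : nat) (I : instance R n) : store R :=
  Store
    (fun x js =>
       match js with
       | [::] => if String.eqb x "n" then n else 0%N
       | [:: j] => if String.eqb x "w" then wt I j else 0%N
       | _ => 0%N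
       end)
    (fun x js =>
       match js with
       | [::] => if String.eqb x "p" then (volume I)%:E
                 else if String.eqb x "alpha" then (alpha I)%:E
                 else if String.eqb x "budget" then (budget I)%:E
                 else 0%E
       | [:: j] => if String.eqb x "r" then (rel I j)%:E
                   else if String.eqb x "d" then (dl I j)%:E
                   else 0%E
       | _ => 0%E
       end).

Definition answer (s : store R) : nat := nmem s "answer" [::].

Definition vec_of (m : nat) (s : store R) (c : nat) : 'rV[R]_m :=
  \row_i fine (rmem s "vec" [:: c; val i]).

(* For each state (k, a, b, w, e) of the dynamic program, some table cell
   labelled with this state contains the value of the recurrence. *)
Definition tabulates (n : nat) (I : instance R n) (m : nat)
    (st : store R) : Prop :=
  forall (k : nat) (a b : 'rV[R]_m) (w : nat) (h : 'I_m) (x : R),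
    (k <= n)%N -> in_Theta I a -> in_Theta I b ->
    (w <= total_weight I)%N ->
    (x = 0 \/ exists2 s, Lambda I s & x = volume I / s) ->
    exists ca cb s : nat,
      [/\ vec_of m st ca = a,
          vec_of m st cb = b,
          rmem st "shift" [:: s] = x%:E
        & rmem st "E" [:: k; ca; cb; w; val h; s]
          = dpE I k a b w (a 0 h + x)].

End InputOutput.

(* Main.v *)
Require Import Defs.
From mathcomp Require Import all_boot all_order all_algebra.
From mathcomp Require Import all_classical all_reals all_analysis.
From mathcomp Require Import zify ring.

(** The base case of the recurrence ignores e, hence so do all its values.  Each
    table cell therefore has a single right value, determined by k, w and the
    codes of a and b, and the minimisation loops run exactly over the choices
    (u, s, h, w') of E', since every vector over Theta has a code and Lambda is
    listed completely.  For the running time, |Theta| <= 8 n^4 gives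
    M <= (8 n^4)^m codes and |Lambda| = L <= 4 n^3; filling one of the n layers
    takes O(M^2 (L + 1) W) cells with O(M L W) candidates each, that is
    O(M^3 L^2 W^2) steps. *)

Set Implicit Arguments.
Unset Strict Implicit.
Unset Printing Implicit Defensive.

Import Order.TTheory GRing.Theory Num.Theory.
Import String.StringSyntax.

Local Open Scope string_scope.
Local Open Scope seq_scope.
Local Open Scope nat_scope.

(** * A program logic with running times *)

(** The lists for Theta and Lambda carry repetitions, so one vector may have many codes. This is
    harmless: the value required of a cell depends on its codes only through the vectors they
    denote, and overwriting a correct cell with its own correct value changes nothing. The invariant
    on the table therefore never records which cells have been visited, only that correct cells stay
    correct. Minima are handled without computing infima: a number is determined by its set of lower
    bounds, and lower bounds of a union of candidate sets follow the nesting of the loops. Times are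
    rounded up, at every loop level, to a constant times the product of the loop lengths. All
    factors of these products are kept positive (L + 1 and W + 1 replace L and W, and M > 0 because
    d_n lies in Theta), so that loop overheads are absorbed by the constants; those that depend on m
    end up in C. *)

Fixpoint nwrites (c : com) (x : var) : bool :=
  match c with
  | Skip | RSet _ _ _ => false
  | NSet y _ _ => String.eqb x y
  | Seq c1 c2 | If _ c1 c2 => nwrites c1 x || nwrites c2 x
  | For i _ c1 => String.eqb x i || nwrites c1 x
  end.

Fixpoint rwrites (c : com) (x : var) : bool :=
  match c with
  | Skip | NSet _ _ _ => false
  | RSet y _ _ => String.eqb x y
  | Seq c1 c2 | If _ c1 c2 => rwrites c1 x || rwrites c2 x
  | For _ _ c1 => rwrites c1 x
  end.

Section Logic.
Context (R : realType).
Implicit Types (s : store R) (c : com) (Q : store R -> Prop).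

(** The frame condition is syntactic and concerns whole array names. For a concrete program the side
    condition computes to [true], which is why [isT] discharges it throughout. *)
Definition unchanged c s s' : Prop :=
  (forall x, ~~ nwrites c x -> nmem s' x = nmem s x) /\
  (forall x, ~~ rwrites c x -> rmem s' x = rmem s x).

Lemma upd_other (A : Type) (f : var -> seq nat -> A) x js v y :
  ~~ String.eqb y x -> upd f x js v y = f y.
Proof. by rewrite /upd; case: String.eqb. Qed.

Lemma upd_same (A : Type) (f : var -> seq nat -> A) x js v ks :
  upd f x js v x ks = if ks == js then v else f x ks.
Proof. by rewrite /upd String.eqb_refl. Qed.

Lemma run_seq c1 c2 s :
  run (Seq c1 c2) s = ((run c2 (run c1 s).1).1,
                       (run c1 s).2 + (run c2 (run c1 s).1).2).
Proof. by rewrite /=; case: (run c1 s) => s1 t1; case: (run c2 s1). Qed.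

Lemma run_if b c1 c2 s :
  run (If b c1 c2) s = ((run (if beval s b then c1 else c2) s).1,
                       (bcost b + (run (if beval s b then c1 else c2) s).2).+1).
Proof. by rewrite /=; case: (run (if _ then _ else _) s). Qed.

Definition step i c (st : store R * nat) j :=
  ((run c (nput st.1 i [::] j)).1, (st.2 + (run c (nput st.1 i [::] j)).2).+1).

Lemma run_for i e c s :
  run (For i e c) s = foldl (step i c) (s, (ncost e).+1) (iota 0 (neval s e)).
Proof.
rewrite /=; elim: (iota _ _) (s, _) => //= j l IH st.
by rewrite -IH /step; case: (run c _).
Qed.

Lemma unchanged_trans c s1 s2 s3 :
  unchanged c s1 s2 -> unchanged c s2 s3 -> unchanged c s1 s3.
Proof.
by move=> [n1 r1] [n2 r2]; split=> x xc; rewrite ?n2 ?r2 ?n1 ?r1.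
Qed.

Lemma unchanged_sub c1 c2 s s' :
  (forall x, nwrites c1 x -> nwrites c2 x) ->
  (forall x, rwrites c1 x -> rwrites c2 x) ->
  unchanged c1 s s' -> unchanged c2 s s'.
Proof.
by move=> n12 r12 [un ur]; split=> x xc; [apply: un|apply: ur];
  apply: contra xc; [apply: n12|apply: r12].
Qed.

Lemma run_unchanged c s : unchanged c s (run c s).1.
Proof.
elim: c s => [|x js e|x js e|c1 IH1 c2 IH2|b c1 IH1 c2 IH2|i e c IH] s.
- by split.
- by split=> //= y xy; rewrite upd_other.
- by split=> //= y xy; rewrite upd_other.
- rewrite run_seq /=; have [n1 r1] := IH1 s; have [n2 r2] := IH2 (run c1 s).1.
  by split=> x /=; rewrite negb_or => /andP[x1 x2]; rewrite ?n2 ?n1 ?r2 ?r1.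
- rewrite run_if /=; have [n1 r1] := IH1 s; have [n2 r2] := IH2 s.
  split=> x /=; rewrite negb_or => /andP[x1 x2];
  by case: ifP => _; rewrite ?n1 ?n2 ?r1 ?r2.
- rewrite run_for; move: (iota _ _) (ncost e).+1 => l; elim: l s => [|j l IHl] s1 t.
    by split.
  apply: unchanged_trans (IHl _ _); have [n1 r1] := IH (nput s1 i [::] j).
  split=> x /=; last by move=> xc; rewrite r1.
  by rewrite negb_or => /andP[xi xc]; rewrite n1//= upd_other.
Qed.

(** Every program terminates, so [run] is a function and a Hoare triple with a time bound is a plain
    statement about its result. *)
Definition ends c s T Q : Prop := Q (run c s).1 /\ (run c s).2 <= T.

Lemma ends_conseq c s T T' Q Q' :
  ends c s T Q -> T <= T' -> (forall s', unchanged c s s' -> Q s' -> Q' s') ->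
  ends c s T' Q'.
Proof.
move=> [q t] TT' QQ'; split; last exact: leq_trans TT'.
by apply: QQ' q; apply: run_unchanged.
Qed.

Lemma ends_skip s T Q : 0 < T -> Q s -> ends Skip s T Q.
Proof. by []. Qed.

Lemma ends_nset x js e s T Q :
  sumn (map ncost js) + ncost e < T ->
  Q (nput s x (map (neval s) js) (neval s e)) -> ends (NSet x js e) s T Q.
Proof. by []. Qed.

Lemma ends_rset x js e s T Q :
  sumn (map ncost js) + rcost e < T ->
  Q (rput s x (map (neval s) js) (reval s e)) -> ends (RSet x js e) s T Q.
Proof. by []. Qed.

(** The second part receives [unchanged c1 s s'] besides P, so P needs to mention only what [c1]
    modifies. *)
Lemma ends_seq P T1 T2 c1 c2 s T Q :
  ends c1 s T1 P ->
  (forall s', unchanged c1 s s' -> P s' -> ends c2 s' T2 Q) ->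
  T1 + T2 <= T -> ends (Seq c1 c2) s T Q.
Proof.
move=> [p t1] c2Q T12; rewrite /ends run_seq.
have [q t2] := c2Q _ (run_unchanged c1 s) p.
by split=> //; apply: leq_trans T12; apply: leq_add.
Qed.

Lemma ends_seqA c1 c2 c3 s T Q :
  ends (Seq (Seq c1 c2) c3) s T Q -> ends (Seq c1 (Seq c2 c3)) s T Q.
Proof. by rewrite /ends !run_seq /= addnA. Qed.

Lemma ends_if T1 b c1 c2 s T Q :
  (beval s b -> ends c1 s T1 Q) -> (~~ beval s b -> ends c2 s T1 Q) ->
  bcost b + T1 < T -> ends (If b c1 c2) s T Q.
Proof.
rewrite /ends run_if /= => c1Q c2Q leT.
have [q t] : Q (run (if beval s b then c1 else c2) s).1 /\
    (run (if beval s b then c1 else c2) s).2 <= T1.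
  by case: (boolP (beval s b)) => [/c1Q|/c2Q].
by split=> //; apply: leq_trans leT; rewrite ltnS leq_add2l.
Qed.

(** The invariant must survive the assignment of the loop variable, which precedes each run of the
    body. The frame condition given to the body reaches back to the state before the loop, so facts
    about untouched memory stay out of the invariant. *)
Lemma ends_for K T1 (Inv : nat -> store R -> Prop) i e c s T Q :
  neval s e = K ->
  Inv 0 s ->
  (forall j s', Inv j s' -> Inv j (nput s' i [::] j)) ->
  (forall j s', j < K -> unchanged (For i e c) s s' ->
     nmem s' i [::] = j -> Inv j s' -> ends c s' T1 (Inv j.+1)) ->
  (ncost e).+1 + K * T1.+1 <= T ->
  (forall s', unchanged (For i e c) s s' -> Inv K s' -> Q s') ->
  ends (For i e c) s T Q.
Proof.
move=> eK Inv0 Invi Invc leT InvQ.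
pose st k := foldl (step i c) (s, (ncost e).+1) (iota 0 k).
suff [] : [/\ unchanged (For i e c) s (st K).1, Inv K (st K).1
  & (st K).2 <= (ncost e).+1 + K * T1.+1].
  move=> u /(InvQ _ u) q t.
  by rewrite /ends run_for eK; split=> //; apply: leq_trans leT.
suff: forall k, k <= K -> [/\ unchanged (For i e c) s (st k).1,
    Inv k (st k).1 & (st k).2 <= (ncost e).+1 + k * T1.+1] by apply.
elim=> [|k IH] kK; first by rewrite addn0.
have [u inv t] := IH (ltnW kK).
have -> : st k.+1 = step i c (st k) k.
  by rewrite /st -[k.+1]addn1 iotaD foldl_cat.
have u1 : unchanged (For i e c) s (nput (st k).1 i [::] k).
  apply: unchanged_trans u _; split=> x //=; rewrite negb_or => /andP[xi _].
  by rewrite upd_other.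
have [] := Invc k _ kK u1 _ (Invi _ _ inv).
  by rewrite /= upd_same.
move=> inv1 t1; split=> //=; last first.
  by rewrite mulSn addnCA addSn ltnS addnC leq_add.
apply: unchanged_trans u1 _.
have [n1 r1] := run_unchanged c (nput (st k).1 i [::] k).
by split=> x /=; [rewrite negb_or => /andP[_] /n1|move=> /r1].
Qed.

End Logic.

(** * The lists computed by the program and the values of the recurrence *)

Section Lists.
Context (R : realType) (n : nat) (I : instance R n).
Local Open Scope ring_scope.

Definition omega_seq : seq R :=
  [seq Defs.rel I j | j <- iota 0 n] ++ [seq dl I j | j <- iota 0 n].

(** The loop counter k starts at 0 and stands for a subdivision into k + 1 parts, hence k + 2
    points. *)
Definition subdivision (a b : R) (k : nat) : seq R :=
  [seq a + l%:R * ((b - a) / k.+1%:R) | l <- iota 0 k.+2].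

Definition theta_block (a b : R) : seq R :=
  if a <= b then flatten [seq subdivision a b k | k <- iota 0 n] else [::].

Definition theta_seq : seq R :=
  flatten [seq flatten [seq theta_block a b | b <- omega_seq] | a <- omega_seq].

Definition lambda_block (a b : R) : seq R :=
  if a < b then [seq l.+1%:R * volume I / (b - a) | l <- iota 0 n] else [::].

Definition lambda_seq : seq R :=
  flatten [seq flatten [seq lambda_block a b | b <- omega_seq] | a <- omega_seq].

Lemma size_omega_seq : size omega_seq = (2 * n)%N.
Proof. by rewrite size_cat !size_map size_iota mul2n addnn. Qed.

Lemma nth_omega_l j : (j < n)%N -> nth 0 omega_seq j = Defs.rel I j.
Proof.
by move=> jn; rewrite nth_cat size_map size_iota jn (nth_map 0%N) ?size_iota// nth_iota.
Qed.

Lemma nth_omega_r j : (j < n)%N -> nth 0 omega_seq (n + j) = dl I j.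
Proof.
move=> jn; rewrite nth_cat size_map size_iota ltnNge leq_addr addKn/=.
by rewrite (nth_map 0%N) ?size_iota// nth_iota.
Qed.

Lemma mem_omega_seq x : x \in omega_seq <-> Omega I x.
Proof.
rewrite mem_cat; split.
  by case/orP=> /mapP[j]; rewrite mem_iota => jn ->; exists j => //; [left|right].
case=> j jn [] ->; apply/orP; [left|right];
  by apply/mapP; exists j; rewrite ?mem_iota.
Qed.

Lemma mem_theta_seq x : x \in theta_seq <-> Theta I x.
Proof.
split.
  move=> /flatten_mapP[a /mem_omega_seq aO /flatten_mapP[b /mem_omega_seq bO]].
  rewrite /theta_block; case: ifP => // ab /flatten_mapP[k].
  rewrite mem_iota => /andP[_ kn] /mapP[l]; rewrite mem_iota => /andP[_ lk] ->.
  by exists a, b; split=> //; exists k.+1, l.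
move=> [a [b [/mem_omega_seq aO /mem_omega_seq bO ab]]].
move=> [k [l [/andP[k0 kn] lk ->]]].
apply/flatten_mapP; exists a => //; apply/flatten_mapP; exists b => //.
rewrite /theta_block ab; apply/flatten_mapP; exists k.-1.
  by rewrite mem_iota; lia.
apply/mapP; exists l; first by rewrite mem_iota; lia.
by rewrite prednK.
Qed.

Lemma mem_lambda_seq x : x \in lambda_seq <-> Lambda I x.
Proof.
split.
  move=> /flatten_mapP[a /mem_omega_seq aO /flatten_mapP[b /mem_omega_seq bO]].
  rewrite /lambda_block; case: ifP => // ab /mapP[l].
  rewrite mem_iota => /andP[_ ln] ->.
  by exists l.+1, a, b; split.
move=> [l [a [b [/andP[l0 ln] /mem_omega_seq aO /mem_omega_seq bO ab ->]]]].
apply/flatten_mapP; exists a => //; apply/flatten_mapP; exists b => //.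
rewrite /lambda_block ab; apply/mapP; exists l.-1; rewrite ?mem_iota; first by lia.
by rewrite prednK.
Qed.

(** Take the degenerate interval from x to x. This puts r_min and d_n into Theta, so the initial and
    final vectors have codes. *)
Lemma Omega_Theta x : (0 < n)%N -> Omega I x -> Theta I x.
Proof.
move=> n0 xO; exists x, x; split=> //; exists 1%N, 0%N; split=> //.
by rewrite mul0r addr0.
Qed.

Lemma size_flatten_le (A B : Type) (f : A -> seq B) (s : seq A) K :
  (forall a, (size (f a) <= K)%N) -> (size (flatten (map f s)) <= size s * K)%N.
Proof.
by move=> fK; elim: s => //= a s IH; rewrite size_cat mulSn leq_add.
Qed.

(** There are (2n)^2 pairs (a, b), and each contributes the sum of k + 2 over k < n, whose n terms
    are at most n + 1 <= 2n. *)
Lemma size_theta_seq : (size theta_seq <= 8 * n ^ 4)%N.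
Proof.
suff h a b : (size (theta_block a b) <= 2 * n ^ 2)%N.
  apply: leq_trans (size_flatten_le _ _) _.
    by move=> a; apply: size_flatten_le (h a).
  by rewrite size_omega_seq !expnS; lia.
rewrite /theta_block; case: ifP => // _.
case: (posnP n) => [-> //|n0].
suff: (size (flatten [seq subdivision a b k | k <- iota 0 n]) <= n * (2 * n))%N.
  by rewrite !expnS; lia.
rewrite size_flatten /shape -map_comp sumnE big_map.
rewrite -[X in (_ <= X * _)%N](size_iota 0).
rewrite -sum1_size big_distrl /= big_seq [X in (_ <= X)%N]big_seq leq_sum// => k.
by rewrite mem_iota /= size_map size_iota; lia.
Qed.

Lemma size_lambda_seq : (size lambda_seq <= 4 * n ^ 3)%N.
Proof.
suff h a b : (size (lambda_block a b) <= n)%N.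
  apply: leq_trans (size_flatten_le _ _) _.
    by move=> a; apply: size_flatten_le (h a).
  by rewrite size_omega_seq !expnS; lia.
by rewrite /lambda_block; case: ifP => // _; rewrite size_map size_iota.
Qed.

End Lists.

(** * Values of the recurrence *)

Section Values.
Context (R : realType) (n : nat) (I : instance R n) (m : nat).
Local Open Scope ring_scope.
Implicit Types a b u : 'rV[R]_m.

Lemma dpE_time_irrelevant k a b w e e' : dpE I k a b w e = dpE I k a b w e'.
Proof.
elim: k a b w e e' => //= k IH a b w e e'; congr mine; first exact: IH.
congr ereal_inf; apply/seteqP; split=> x [u [s [h [w' /= [H1 H2 H3 H4 ->]]]]];
  by exists u, s, h, w' => /=; split=> //; rewrite (IH a u w' e e').
Qed.

(** Scheduling no job costs nothing. With a nonnegative budget this makes weight 0 feasible, so a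
    best weight always exists. *)
Lemma dpE_weight0 k a b e : (dpE I k a b 0%N e <= 0)%E.
Proof.
elim: k => [|k IH] /=; first exact: lexx.
by rewrite ge_min IH.
Qed.

Lemma le_bigmin_seq (z x0 : int) (l : seq int) :
  (z <= \big[Num.min/x0]_(x <- l) x) = (z <= x0) && all (fun x => z <= x) l.
Proof.
elim: l => [|x l IH]; first by rewrite big_nil andbT.
by rewrite big_cons le_min IH /= andbCA.
Qed.

(** The default value of the iterated minimum is the first release date, itself in the list because
    n > 0, so the minimum is attained in the list. *)
Lemma Omega_rmin : (0 < n)%N -> Omega I (rmin I).
Proof.
move=> n0; set l : seq int := release I.
have sl : size l = n by rewrite size_tuple.
have bigmin_in (t : seq int) y : y \in l -> {subset t <= l} ->
    \big[Num.min/y]_(x <- t) x \in l.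
  move=> yl; elim: t => [|x t IH] h; first by rewrite big_nil.
  rewrite big_cons minEle; case: ifP => _; first by apply: h; rewrite mem_head.
  by apply: IH => z zt; apply: h; rewrite inE zt orbT.
have /bigmin_in/(_ (fun=> id)) : nth 0 l 0 \in l by rewrite mem_nth// sl.
move=> /(nthP 0)[j]; rewrite sl => jn e; exists j => //; left.
by rewrite /Defs.rel /rmin e.
Qed.

Lemma Omega_dlast : (0 < n)%N -> Omega I (dlast I).
Proof. by move=> n0; exists n.-1; [rewrite prednK|right]. Qed.

End Values.

(** * Numerals in base N *)

Lemma digits_exist (N : nat) (f : nat -> nat) (k : nat) :
  (forall i, i < k -> f i < N) ->
  exists2 c, c < N ^ k & forall i, i < k -> (c %/ N ^ i) %% N = f i.
Proof.
elim: k => [|k IH] fN; first by exists 0.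
have [c ck cf] := IH (fun i ik => fN i (ltnW ik)).
have N0 : 0 < N by apply: leq_ltn_trans (fN k _).
exists (f k * N ^ k + c) => [|i].
  rewrite expnS; apply: (@leq_trans ((f k).+1 * N ^ k)).
    by rewrite mulSn addnC ltn_add2r.
  by rewrite leq_mul2r fN ?orbT.
rewrite ltnS leq_eqVlt => /orP[/eqP ->|ik].
  by rewrite divnMDl ?expn_gt0 ?N0// divn_small// addn0 modn_small ?fN.
(* The new leading term is a multiple of N ^ (i + 1), so it leaves the digit at position i < k
   alone. *)
have -> : N ^ k = N ^ (k - i.+1) * N * N ^ i.
  by rewrite -expnSr -expnD addSnnS subnK.
by rewrite !mulnA divnMDl ?expn_gt0 ?N0// modnMDl cf.
Qed.

(** * The preliminary phases *)

Lemma map_nth_iota (T U : Type) (x0 : T) (f : T -> U) (s : seq T) k :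
  size s = k -> [seq f (nth x0 s i) | i <- iota 0 k] = map f s.
Proof. by move=> <-; rewrite -[in RHS](mkseq_nth x0 s) -map_comp. Qed.

Section Arrays.
Context (R : realType).
Implicit Types (s : store R) (l : seq R).

Definition array s (x : var) l : Prop :=
  forall j, j < size l -> rmem s x [:: j] = (nth 0%R l j)%:E.

Definition listed s (x N : var) l : Prop :=
  nmem s N [::] = size l /\ array s x l.

Lemma ends_push s (x N : var) l v a T :
  listed s x N l -> reval s v = a%:E -> rcost v + 7 <= T ->
  ends (Seq (RSet x [:: NGet N [::]] v)
            (NSet N [::] (NAdd (NGet N [::]) (NConst 1)))) s T
    (fun s' => listed s' x N (l ++ [:: a])).
Proof.
move=> [sN sl] va leT.
apply: (@ends_seq _ (fun s' => nmem s' N [::] = size l /\ array s' x (l ++ [:: a]))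
    (rcost v + 3) 4); last by lia.
  apply: ends_rset => /=; first by lia.
  split=> // j; rewrite size_cat /= addn1 ltnS leq_eqVlt => jl.
  rewrite upd_same va sN eqseq_cons eqxx andbT nth_cat.
  by case: ltngtP jl => // [jl _|->]; [exact: sl|rewrite subnn].
move=> s' _ [sN' sl']; apply: ends_nset => //; split=> //=.
by rewrite upd_same/= sN' size_cat.
Qed.

(** Since the conclusion has the same form as the hypothesis on the body, nested enumeration loops
    are handled by nested applications. The counter N must differ from the loop variable, whose
    assignment would destroy it. *)
Lemma ends_append K T1 (f : nat -> seq R) l l' i e c s T x N :
  ~~ String.eqb N i -> neval s e = K ->
  listed s x N l ->
  (forall j l' s', j < K -> unchanged (For i e c) s s' ->
     nmem s' i [::] = j -> listed s' x N l' ->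
     ends c s' T1 (fun s'' => listed s'' x N (l' ++ f j))) ->
  (ncost e).+1 + K * T1.+1 <= T ->
  l ++ flatten (map f (iota 0 K)) = l' ->
  ends (For i e c) s T (fun s' => listed s' x N l').
Proof.
move=> Ni eK sl cf leT <-.
apply: (ends_for (Inv := fun j s' =>
  listed s' x N (l ++ flatten (map f (iota 0 j)))) eK _ _ _ leT) => //.
- by rewrite cats0.
- by move=> j s' [h1 h2]; split=> //=; rewrite upd_other.
- move=> j s' jK u ij sl'.
  by rewrite -[in _.+1]addn1 iotaD map_cat flatten_cat catA /= cats0; apply: cf.
Qed.

Definition coordinate (th : seq R) (c i : nat) : R :=
  nth 0%R th ((c %/ size th ^ i) %% size th).

Lemma compute_vectors_ends m s (th : seq R) :
  listed s "Theta" "N" th ->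
  ends (compute_vectors m) s (30 * (m + 1) * (size th ^ m + 1)) (fun s' =>
    nmem s' "M" [::] = size th ^ m /\
    forall c i, c < size th ^ m -> i < m -> rmem s' "vec" [:: c; i] =
      (coordinate th c i)%:E).
Proof.
move=> [sN sth]; set N := size th.
apply: (@ends_seq _ (fun s' => nmem s' "M" [::] = 1) 2 
  (28 * (m + 1) * (N ^ m + 1))); last by lia.
  exact: ends_nset.
move=> s1 u1 s1M; have s1N : nmem s1 "N" [::] = N by rewrite (u1.1 "N" isT).
have s1th : array s1 "Theta" th by move=> j jN; rewrite (u1.2 "Theta" isT) sth.
apply: (@ends_seq _ (fun s' => nmem s' "M" [::] = N ^ m /\
    forall i, i < m -> nmem s' "base" [:: i] = N ^ i) (2 + m * 9)
  (2 + N ^ m * (2 + m * 21).+1)); last by nia.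
- apply: (@ends_for _ m 8 (fun j s' => nmem s' "M" [::] = N ^ j /\
    forall i, i < j -> nmem s' "base" [:: i] = N ^ i)) => //=.
  move=> j s2 jm u2 s2j [s2M s2b].
  have s2N : nmem s2 "N" [::] = N by rewrite (u2.1 "N" isT).
  apply: (@ends_seq _ (fun s' => nmem s' "M" [::] = N ^ j /\
    forall i, i < j.+1 -> nmem s' "base" [:: i] = N ^ i) 4 4) => //.
    apply: ends_nset => //=; split=> // i; rewrite ltnS => ij.
    rewrite upd_same s2j s2M eqseq_cons andbT.
    by case: eqP => [->//|/eqP ij']; apply: s2b; rewrite ltn_neqAle ij'.
  move=> s3 u3 [s3M s3b]; apply: ends_nset => //=; split=> //.
  by rewrite upd_same/= s3M (u3.1 "N" isT) s2N expnSr.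
- move=> s2 u2 [s2M s2b].
  have s2N : nmem s2 "N" [::] = N by rewrite (u2.1 "N" isT).
  apply: (@ends_for _ (N ^ m) (2 + m * 21) (fun j s' => forall c i, c < j ->
    i < m -> rmem s' "vec" [:: c; i] =
      (coordinate th c i)%:E)) => //=; last first.
    by move=> s3 u3 h; split=> //; rewrite (u3.1 "M" isT).
  move=> c s3 cN u3 s3c s3v.
  (* The entries already written are those that precede (c, i) lexicographically. *)
  apply: (@ends_for _ m 20 (fun i s' => forall c' i', (c' < c) && (i' < m) ||
    (c' == c) && (i' < i) -> rmem s' "vec" [:: c'; i'] =
      (coordinate th c' i')%:E)) => //=.
  + by move=> c' i' /orP[/andP[]|/andP[]//]; exact: s3v.
  + move=> i s4 im u4 s4i s4v; apply: ends_rset => //= c' i' h.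
    rewrite upd_same (u4.1 "c" isT) s3c s4i !eqseq_cons andbT.
    case: ifP => [/andP[/eqP -> /eqP ->]|ne].
      rewrite (u4.1 "N" isT) (u3.1 "N" isT) s2N.
      rewrite (u4.1 "base" isT) (u3.1 "base" isT) s2b//.
      rewrite (u4.2 "Theta" isT) (u3.2 "Theta" isT) (u2.2 "Theta" isT) s1th//.
      (* A code c < N ^ m with m > 0 forces N > 0, so the digit is a valid index into the list. *)
      rewrite ltn_mod lt0n; apply: contraTneq cN => N0.
      by rewrite -/N N0 exp0n// (leq_ltn_trans _ im).
    by apply: s4v; lia.
  + move=> s4 _ h c' i'; rewrite ltnS leq_eqVlt => h1 h2; apply: h; lia.
Qed.

End Arrays.

(** * Omega, Theta, Lambda, the shifts and the scalars *)

Section Setup.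
Context (R : realType) (n : nat) (I : instance R n).
Hypothesis n_gt0 : 0 < n.
Implicit Types (s : store R).

Lemma compute_Omega_ends s :
  nmem s "n" [::] = n ->
  (forall j, rmem s "r" [:: j] = (Defs.rel I j)%:E) ->
  (forall j, rmem s "d" [:: j] = (dl I j)%:E) ->
  ends compute_Omega s (22 * n) (fun s' => array s' "Omega" (omega_seq I)).
Proof.
move=> sn sr sd.
apply: (@ends_for _ n 19 (fun j s' => forall k, k < j ->
  rmem s' "Omega" [:: k] = (Defs.rel I k)%:E /\
  rmem s' "Omega" [:: n + k] = (dl I k)%:E)) => //=; rewrite ?sn//.
- move=> j s' jn u sj inv.
  split=> //= k; rewrite ltnS => kj; rewrite /upd /= sj.
  rewrite (u.1 "n" isT) sn !eqseq_cons !andbT.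
  rewrite eqn_add2l (u.2 "r" isT) (u.2 "d" isT) sr sd.
  (* The release dates occupy positions below n and the deadlines positions from n on, so the two
     writes do not interfere. *)
  have -> : (k == n + j) = false by lia.
  have -> : (n + k == j) = false by lia.
  by case: eqP => [->//|kj']; apply: inv; lia.
- by lia.
- move=> s' _ inv j; rewrite size_omega_seq => jn.
  have [jn'|nj] := ltnP j n; first by rewrite (inv j jn').1 nth_omega_l.
  by rewrite -(subnKC nj) (inv _ _).2 ?nth_omega_r//; lia.
Qed.

Lemma compute_Theta_ends s :
  nmem s "n" [::] = n -> array s "Omega" (omega_seq I) ->
  ends compute_Theta s (400 * n ^ 4)
    (fun s' => listed s' "Theta" "N" (theta_seq I)).
Proof.
move=> sn sO; rewrite /compute_Theta; cbv zeta.
(* Comparisons of powers for [nia]: the overhead of each loop is of lower order in n and is absorbed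
   into the leading power. *)
have n2 : n <= n * n by rewrite leq_pmulr.
have n3 : n * n <= n * (n * n) by rewrite leq_pmull.
have n4 : n * (n * n) <= n * (n * (n * n)) by rewrite leq_pmull.
apply: (@ends_seq _ (fun s' => listed s' "Theta" "N" [::]) 2 (398 * n ^ 4)).
- exact: ends_nset.
- move=> s1 u1 l1; have sn1 : nmem s1 "n" [::] = n by rewrite (u1.1 "n" isT).
  have sO1 : array s1 "Omega" (omega_seq I).
    by move=> j jO; rewrite (u1.2 "Omega" isT) sO.
  apply: (@ends_append _ (2 * n) (170 * n ^ 3) (fun i => flatten
      [seq theta_block n (nth 0%R (omega_seq I) i) b | b <- omega_seq I])
    [::]) => //=.
  + by rewrite sn1.
  + move=> i l s2 ni u2 s2i l2.
    apply: (@ends_append _ (2 * n) (80 * n ^ 2) (fun j =>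
      theta_block n (nth 0%R (omega_seq I) i) (nth 0%R (omega_seq I) j)) l) => //=.
    * by rewrite (u2.1 "n" isT) sn1.
    * move=> j l' s3 nj u3 s3j l3.
      have s3O : array s3 "Omega" (omega_seq I).
        by move=> k ko; rewrite (u3.2 "Omega" isT) (u2.2 "Omega" isT) sO1.
      have s3i : nmem s3 "i" [::] = i by rewrite (u3.1 "i" isT).
      have s3n : nmem s3 "n" [::] = n by rewrite (u3.1 "n" isT) (u2.1 "n" isT).
      rewrite /theta_block.
      set a := nth 0%R _ i; set b := nth 0%R _ j.
      have s3a : rmem s3 "Omega" [:: i] = a%:E by rewrite s3O// size_omega_seq.
      have s3b : rmem s3 "Omega" [:: j] = b%:E by rewrite s3O// size_omega_seq.
      apply: (@ends_if _ (73 * n ^ 2)) => /=.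
      - rewrite s3i s3j s3a s3b lee_fin => -> /=.
        apply: (@ends_append _ n (70 * n) (subdivision a b) l') => //=.
          move=> k lk s4 kn u4 s4k l4.
          apply: (@ends_append _ k.+2 30
            (fun l => [:: a + l%:R * ((b - a) / k.+1%:R)]%R) lk) => //=.
          + by rewrite s4k addn2.
          + move=> p lp s5 pk u5 s5p l5; apply: ends_push => //=.
            rewrite s5p (u5.1 "i" isT) (u5.1 "j" isT) (u5.1 "k" isT).
            rewrite (u4.1 "i" isT) (u4.1 "j" isT) s4k s3i s3j.
            rewrite (u5.2 "Omega" isT) (u4.2 "Omega" isT) s3a s3b.
            by rewrite /on_finite /= addn1.
          + by lia.
          + by rewrite flatten_map1.
        + by rewrite !expnS; nia.
      - rewrite s3i s3j s3a s3b lee_fin => /negbTE ->; rewrite cats0.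
        by apply: ends_skip; rewrite // muln_gt0 expn_gt0 n_gt0.
      - by rewrite !expnS; nia.
    * by rewrite !expnS; nia.
    * by rewrite (map_nth_iota _ _ (size_omega_seq I)).
  + by rewrite !expnS; nia.
  + by rewrite (map_nth_iota _ (fun a => flatten
      [seq theta_block n a b | b <- omega_seq I]) (size_omega_seq I)).
- by rewrite !expnS; nia.
Qed.

Lemma compute_Lambda_ends s :
  nmem s "n" [::] = n -> array s "Omega" (omega_seq I) ->
  rmem s "p" [::] = (volume I)%:E ->
  ends compute_Lambda s (200 * n ^ 3)
    (fun s' => listed s' "Lambda" "L" (lambda_seq I)).
Proof.
move=> sn sO sp; rewrite /compute_Lambda; cbv zeta.
have n2 : n <= n * n by rewrite leq_pmulr.
have n3 : n * n <= n * (n * n) by rewrite leq_pmull.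
apply: (@ends_seq _ (fun s' => listed s' "Lambda" "L" [::]) 2 (198 * n ^ 3)).
- exact: ends_nset.
- move=> s1 u1 l1; have sn1 : nmem s1 "n" [::] = n by rewrite (u1.1 "n" isT).
  have sO1 : array s1 "Omega" (omega_seq I).
    by move=> j jO; rewrite (u1.2 "Omega" isT) sO.
  apply: (@ends_append _ (2 * n) (90 * n ^ 2) (fun i => flatten
      [seq lambda_block I (nth 0%R (omega_seq I) i) b | b <- omega_seq I])
    [::]) => //=.
  + by rewrite sn1.
  + move=> i l s2 ni u2 s2i l2.
    apply: (@ends_append _ (2 * n) (42 * n) (fun j =>
      lambda_block I (nth 0%R (omega_seq I) i) (nth 0%R (omega_seq I) j)) l) => //=.
    * by rewrite (u2.1 "n" isT) sn1.
    * move=> j l' s3 nj u3 s3j l3.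
      have s3O : array s3 "Omega" (omega_seq I).
        by move=> k ko; rewrite (u3.2 "Omega" isT) (u2.2 "Omega" isT) sO1.
      have s3i : nmem s3 "i" [::] = i by rewrite (u3.1 "i" isT).
      have s3n : nmem s3 "n" [::] = n by rewrite (u3.1 "n" isT) (u2.1 "n" isT).
      have s3p : rmem s3 "p" [::] = (volume I)%:E.
        by rewrite (u3.2 "p" isT) (u2.2 "p" isT) (u1.2 "p" isT).
      rewrite /lambda_block.
      set a := nth 0%R _ i; set b := nth 0%R _ j.
      have s3a : rmem s3 "Omega" [:: i] = a%:E by rewrite s3O// size_omega_seq.
      have s3b : rmem s3 "Omega" [:: j] = b%:E by rewrite s3O// size_omega_seq.
      apply: (@ends_if _ (35 * n)) => /=.
      - rewrite s3i s3j s3a s3b lte_fin => -> /=.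
        apply: (@ends_append _ n 30
            (fun l => [:: l.+1%:R * volume I / (b - a)]%R) l') => //=.
        + move=> k lk s4 kn u4 s4k l4; apply: ends_push => //=.
          rewrite s4k (u4.1 "i" isT) (u4.1 "j" isT) s3i s3j.
          rewrite (u4.2 "Omega" isT) (u4.2 "p" isT) s3a s3b s3p.
          by rewrite /on_finite /= addn1.
        + by lia.
        + by rewrite flatten_map1.
      - rewrite s3i s3j s3a s3b lte_fin => /negbTE ->; rewrite cats0.
        by apply: ends_skip; rewrite // muln_gt0 n_gt0.
      - by lia.
    * by rewrite !expnS; nia.
    * by rewrite (map_nth_iota _ _ (size_omega_seq I)).
  + by rewrite !expnS; nia.
  + by rewrite (map_nth_iota _ (fun a => flatten
      [seq lambda_block I a b | b <- omega_seq I]) (size_omega_seq I)).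
- by rewrite !expnS; nia.
Qed.

Lemma compute_shift_ends s :
  listed s "Lambda" "L" (lambda_seq I) -> rmem s "p" [::] = (volume I)%:E ->
  ends compute_shift s (12 * (size (lambda_seq I)).+1) (fun s' =>
    array s' "shift" (rcons [seq (volume I / x)%R | x <- lambda_seq I] 0%R)).
Proof.
move=> [sL sl] sp; set L := size (lambda_seq I).
apply: (@ends_seq _ (fun s' => forall j, j < L ->
  rmem s' "shift" [:: j] = ((volume I / nth 0 (lambda_seq I) j)%R)%:E)
  (2 + L * 10) 8) => /=; last by lia.
- apply: (@ends_for _ L 9 (fun j s' => forall k, k < j ->
    rmem s' "shift" [:: k] = ((volume I / nth 0 (lambda_seq I) k)%R)%:E)) => //=.
  move=> j s' jL u s'j inv.
  apply: ends_rset => // k; rewrite ltnS /= upd_same s'j eqseq_cons andbT => kj.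
  case: eqP => [->|/eqP kj']; last by apply: inv; rewrite ltn_neqAle kj'.
  by rewrite (u.2 "p" isT) (u.2 "Lambda" isT) sp sl.
- move=> s1 u1 inv; apply: ends_rset => // j; rewrite /= upd_same.
  rewrite size_rcons size_map ltnS leq_eqVlt (u1.1 "L" isT) sL -/L.
  rewrite nth_rcons size_map -/L eqseq_cons andbT.
  case: eqP => [-> _|_ /= jL]; first by rewrite ltnn.
  by rewrite jL inv// (nth_map 0%R).
Qed.

Lemma compute_weight_ends s :
  nmem s "n" [::] = n -> (forall j, nmem s "w" [:: j] = wt I j) ->
  ends compute_weight s (12 * n)
    (fun s' => nmem s' "W" [::] = total_weight I).
Proof.
move=> sn sw; apply: (@ends_seq _ (fun s' => nmem s' "W" [::] = 0) 2 (2 + n * 7)).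
- exact: ends_nset.
- move=> s1 u1 s1W.
  apply: (@ends_for _ n 6 (fun j s' =>
    nmem s' "W" [::] = sumn (take j (weight I)))) => //=.
  + by rewrite (u1.1 "n" isT).
  + by rewrite take0.
  + move=> j s2 jn u2 s2j s2W; apply: ends_nset => //=.
    rewrite upd_same/= s2W s2j (u2.1 "w" isT) (u1.1 "w" isT) sw.
    by rewrite (take_nth 0) ?size_tuple// sumn_rcons.
  + by move=> s2 _; rewrite take_oversize// size_tuple.
- by lia.
Qed.

Lemma compute_rmin_ends s :
  nmem s "n" [::] = n -> (forall j, rmem s "r" [:: j] = (Defs.rel I j)%:E) ->
  ends compute_rmin s (20 * n) (fun s' => rmem s' "rmin" [::] = (rmin I)%:E).
Proof.
move=> sn sr; set r : seq int := release I.
(* The running minimum is described by its lower bounds; [le_bigmin_seq] describes the big minimum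
   in the same way, and antisymmetry identifies the two at the end. *)
pose lb j (z : int) := (z <= nth 0 r 0)%R && all (fun x => z <= x)%R (take j r).
pose inv j s' := exists v : int, rmem s' "rmin" [::] = (v%:~R)%R%:E /\
  forall z : int, (z <= v)%R = lb j z.
apply: (@ends_seq _ (inv 0) 4 (2 + n * 14)); last by lia.
  apply: ends_rset => //; exists (nth 0%R r 0); split.
    by rewrite /= upd_same /= sr.
  by move=> z; rewrite /lb take0 andbT.
move=> s1 u1 inv1.
apply: (@ends_for _ n 13 inv) => //=.
- by rewrite (u1.1 "n" isT).
- move=> j s2 jn u2 s2j [v [s2v vlb]].
  have s2r : rmem s2 "r" [:: j] = ((nth 0%R r j)%:~R)%R%:E.
    by rewrite (u2.2 "r" isT) (u1.2 "r" isT) sr.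
  have lbS z : lb j.+1 z = lb j z && (z <= nth 0 r j)%R.
    by rewrite /lb (take_nth 0%R) ?size_tuple// all_rcons andbAC andbA.
  apply: (@ends_if _ 5) => //=; rewrite s2j s2v s2r lte_fin ltr_int.
  + move=> rv; apply: ends_rset => //; exists (nth 0%R r j); split.
      by rewrite /= upd_same /= s2j s2r.
    move=> z; rewrite lbS -vlb; case: (boolP (z <= nth 0 r j)%R) => h; rewrite ?andbF//.
    by rewrite andbT (le_trans h (ltW rv)).
  + rewrite -leNgt => vr; apply: ends_skip => //; exists v; split=> // z.
    rewrite lbS -vlb; case: (boolP (z <= v)%R) => h //.
    by rewrite (le_trans h vr).
- move=> s2 _ [v [-> vlb]]; congr (_%:E); rewrite /rmin -/r; congr (_%:~R)%R.
  move: vlb; rewrite /lb take_oversize ?size_tuple// => vlb.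
  by apply/le_anti; rewrite le_bigmin_seq -vlb lexx /= vlb -le_bigmin_seq lexx.
Qed.

End Setup.

(** * Codes of vectors *)

(** As K' * P > 0, both the overhead A and the extra step of each iteration fit into multiples of
    it. The coefficient grows only additively, so it stays small under nesting. *)
Lemma loop_time A K K' c P :
  K <= K' -> 0 < K' -> 0 < P -> A + K * (c * P).+1 <= (c + A + 1) * (K' * P).
Proof.
move=> KK' K0 P0; have KP : 0 < K' * P by rewrite muln_gt0 K0.
have h1 : K * (c * P) <= c * (K' * P) by rewrite mulnCA leq_mul// leq_mul.
have h2 : K <= K' * P by apply: leq_trans KK' _; rewrite leq_pmulr.
have h3 : A <= A * (K' * P) by rewrite leq_pmulr.
rewrite mulnS !mulnDl mul1n; lia.
Qed.

Lemma all_iota_rcons (P : pred nat) k : all P (iota 0 k.+1) = all P (iota 0 k) && P k.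
Proof. by rewrite -[k.+1]addn1 iotaD all_cat /= add0n andbT. Qed.

Lemma has_iota_rcons (P : pred nat) k : has P (iota 0 k.+1) = has P (iota 0 k) || P k.
Proof. by rewrite -[k.+1]addn1 iotaD has_cat /= add0n orbF. Qed.

Section Tables.
Context (R : realType) (n : nat) (I : instance R n) (m : nat).
Hypotheses (n_gt0 : 0 < n) (m_gt0 : 0 < m).
Implicit Types (s : store R) (k a b u w h q : nat).

Let th := theta_seq I.
Let lam := lambda_seq I.
Let M := size th ^ m.
Let L := size lam.
Let W := total_weight I.

Definition vector_of_code (c : nat) : 'rV[R]_m := \row_i coordinate th c i.
Local Notation V := vector_of_code.

Record env s : Prop := Env {
  env_n : nmem s "n" [::] = n;
  env_M : nmem s "M" [::] = M;
  env_L : nmem s "L" [::] = L;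
  env_W : nmem s "W" [::] = W;
  env_w : forall j, nmem s "w" [:: j] = wt I j;
  env_r : forall j, rmem s "r" [:: j] = (Defs.rel I j)%:E;
  env_d : forall j, rmem s "d" [:: j] = (dl I j)%:E;
  env_p : rmem s "p" [::] = (volume I)%:E;
  env_alpha : rmem s "alpha" [::] = (alpha I)%:E;
  env_lambda : array s "Lambda" lam;
  env_vec : forall c i, c < M -> i < m -> rmem s "vec" [:: c; i] = (coordinate th c i)%:E }.

(** Boolean, so that preservation of [env] by a concrete piece of the program is settled by
    computation. *)
Definition env_safe (c : com) : bool :=
  all (fun x => ~~ nwrites c x) [:: "n"; "M"; "L"; "W"; "w"] &&
  all (fun x => ~~ rwrites c x) [:: "r"; "d"; "p"; "alpha"; "Lambda"; "vec"].

Lemma env_unchanged c s s' : env_safe c -> unchanged c s s' -> env s -> env s'.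
Proof.
move=> /andP[/= /and5P[n1 n2 n3 n4 /andP[n5 _]]].
move=> /and5P[r1 r2 r3 r4 /and3P[r5 r6 _]] [un ur] [] *.
by split; try (move=> j j'; rewrite ur//; auto); rewrite /array ?un ?ur.
Qed.

Lemma Theta_code (f : nat -> nat) : (forall i, i < m -> f i < size th) ->
  exists2 c, c < M & forall i, i < m -> coordinate th c i = nth 0%R th (f i).
Proof.
by move=> /digits_exist[c cM cf]; exists c => // i im; rewrite /coordinate cf.
Qed.

Lemma vector_of_code_surj (v : 'rV[R]_m) : in_Theta I v ->
  exists2 c, c < M & V c = v.
Proof.
move=> vT; pose f (i : nat) := if insub i is Some j then index (v ord0 j) th else 0.
have [i im|c cM cf] := @Theta_code f.
  by rewrite /f insubT index_mem; apply/mem_theta_seq.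
exists c => //; apply/rowP => i; rewrite mxE cf// /f valK nth_index//.
by apply/mem_theta_seq.
Qed.

Lemma size_theta_gt0 : 0 < size th.
Proof.
have /mem_theta_seq : Theta I (dlast I) by apply: Omega_Theta; [|apply: Omega_dlast].
by rewrite -/th; case: th.
Qed.

Lemma M_gt0 : 0 < M. Proof. by rewrite expn_gt0 size_theta_gt0. Qed.

Lemma vector_of_code_Theta c : in_Theta I (V c).
Proof.
by move=> i; rewrite mxE; apply/mem_theta_seq/mem_nth; rewrite ltn_mod size_theta_gt0.
Qed.

(** The search keeps the last match. Its invariant is conditional on a match among the codes seen so
    far, and surjectivity of the coding provides one at the end. The value of v is assumed in every
    state that differs from s only where the loop writes, since v is evaluated anew for each
    coordinate. *)
Lemma find_constant_ends x v y s :
  ~~ String.eqb x "c" -> ~~ String.eqb x "i" -> ~~ String.eqb x "ok" ->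
  ~~ String.eqb "M" x -> ~~ String.eqb "c" x ->
  env s -> in_Theta I (const_mx y : 'rV_m) ->
  (forall s', unchanged (find_constant m x v) s s' -> reval s' v = y%:E) ->
  ends (find_constant m x v) s ((20 + 2 * rcost v) * (m + 1) * M * 3)
    (fun s' => nmem s' x [::] < M /\ V (nmem s' x [::]) = const_mx y).
Proof.
move=> xc xi xok Mx cx se yT sv.
have [c0 c0M Vc0] := vector_of_code_surj yT.
pose T1 := 2 + m * (14 + 2 * rcost v).+1.
apply: (@ends_for _ M (T1 + 10) (fun j s' =>
  (exists2 c, c < j & V c = const_mx y) ->
  nmem s' x [::] < M /\ V (nmem s' x [::]) = const_mx y)) => /=.
- exact: env_M.
- by case.
- by move=> j s' inv /inv; rewrite upd_other.
- move=> c s1 cM u1 s1c inv.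
  pose e k := all (fun i => coordinate th c i == y) (iota 0 k).
  have eV : e m -> V c = const_mx y.
    move=> /allP h; apply/rowP => i; rewrite !mxE; apply/eqP/h.
    by rewrite mem_iota ltn_ord.
  have Ve : V c = const_mx y -> e m.
    move=> h; apply/allP => i; rewrite mem_iota => /andP[_ im].
    by have /rowP/(_ (Ordinal im)) := h; rewrite !mxE => ->.
  have s1vec i : i < m -> rmem s1 "vec" [:: c; i] = (coordinate th c i)%:E.
    by move=> im; rewrite (u1.2 "vec" isT) (env_vec se).
  pose P s' := (exists2 c', c' < c & V c' = const_mx y) ->
    nmem s' x [::] < M /\ V (nmem s' x [::]) = const_mx y.
  apply: (@ends_seq _ (fun s' => nmem s' "ok" [::] = 1 /\ P s') 2 (T1 + 8)); last by lia.
    apply: ends_nset => //; split=> //=; rewrite /P /= upd_other//.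
  move=> s2 u2 [s2ok P2].
  apply: (@ends_seq _ (fun s' => nmem s' "ok" [::] = e m /\ P s') T1 8); last by lia.
    apply: (@ends_for _ m (14 + 2 * rcost v) (fun j s' =>
      nmem s' "ok" [::] = e j /\ P s')) => //=.
      by move=> j s' [h1 h2]; split=> //; rewrite /P /= upd_other.
    move=> i s3 im u3 s3i [s3ok P3].
    have s3vec : rmem s3 "vec" [:: c; i] = (coordinate th c i)%:E.
      by rewrite (u3.2 "vec" isT) (u2.2 "vec" isT) s1vec.
    have s3c : nmem s3 "c" [::] = c by rewrite (u3.1 "c" isT) (u2.1 "c" isT).
    have s3v : reval s3 v = y%:E.
      apply: sv; apply: unchanged_trans u1 (unchanged_trans (s2 := s2) _ _).
        by apply: unchanged_sub u2 => z //= ->; rewrite ?orbT.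
      by apply: unchanged_sub u3 => z //= ->; rewrite ?orbT.
    rewrite /e all_iota_rcons -/(e i).
    apply: (@ends_if _ 3) => /=; rewrite ?s3c ?s3i ?s3vec ?s3v ?lee_fin.
    + rewrite -eq_le => /eqP ->; rewrite eqxx andbT; exact: ends_skip.
    + rewrite -eq_le => /negbTE ->; rewrite andbF; apply: ends_nset => //.
      by split=> //; rewrite /P /= upd_other.
    + lia.
  move=> s3 u3 [s3ok P3].
  have s3c : nmem s3 "c" [::] = c by rewrite (u3.1 "c" isT) (u2.1 "c" isT).
  have done_ s4 : P s4 -> ~~ e m -> (exists2 c', c' < c.+1 & V c' = const_mx y) ->
      nmem s4 x [::] < M /\ V (nmem s4 x [::]) = const_mx y.
    move=> P4 ne [c']; rewrite ltnS leq_eqVlt => /orP[/eqP -> /Ve|c'c h].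
      by move=> em; rewrite em in ne.
    by apply: P4; exists c'.
  apply: (@ends_if _ 3) => //=; rewrite s3ok; case: (boolP (e m)) => // em _.
    apply: ends_nset => //= _; rewrite upd_same/= s3c; split=> //; exact: eV.
  by apply: ends_skip => //; apply: done_.
- apply: (@leq_trans (((T1 + 10).+1 + 2) * M)).
    by have := M_gt0; rewrite -/M; nia.
  by rewrite mulnAC leq_mul2r /T1; apply/orP; right; nia.
- by move=> s1 _ h; apply: h; exists c0.
Qed.

Definition between a u b : bool :=
  all (fun i =>
    coordinate th a i <= coordinate th u i <= coordinate th b i)%R (iota 0 m).

Definition differ u b : bool :=
  has (fun i => coordinate th u i != coordinate th b i)%R (iota 0 m).

Lemma betweenP a u b :
  between a u b && differ u b <-> vle (V a) (V u) /\ vlt (V u) (V b).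
Proof.
split.
  move=> /andP[/allP h /hasP[i0]]; rewrite mem_iota => /andP[_ i0m] ne.
  have mi (i : 'I_m) : val i \in iota 0 m by rewrite mem_iota ltn_ord.
  split; [|split].
  - by move=> i; rewrite !mxE; case/andP: (h _ (mi i)).
  - by move=> i; rewrite !mxE; case/andP: (h _ (mi i)).
  - by move=> /rowP/(_ (Ordinal i0m)); rewrite !mxE /= => e; rewrite e eqxx in ne.
move=> [h1 [h2 h3]]; apply/andP; split.
  apply/allP => i; rewrite mem_iota => /andP[_ im].
  by move: (h1 (Ordinal im)) (h2 (Ordinal im)); rewrite !mxE /= => -> ->.
apply: contra_notT h3 => /hasPn h; apply/rowP => i; rewrite !mxE; apply/eqP.
by have := h i; rewrite mem_iota ltn_ord negbK; apply.
Qed.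

Lemma compare_vectors_ends a b u s :
  env s -> nmem s "a" [::] = a -> nmem s "b" [::] = b -> nmem s "u" [::] = u ->
  a < M -> b < M -> u < M ->
  ends (compare_vectors m) s (6 + m * 50) (fun s' =>
    nmem s' "ok" [::] = between a u b /\ nmem s' "strict" [::] = differ u b).
Proof.
move=> se sa sb su aM bM uM; rewrite /compare_vectors; cbv zeta.
apply: (@ends_seq _ (fun s' => nmem s' "ok" [::] = 1) 2 (4 + m * 50)) => //.
move=> s1 u1 s1ok.
apply: (@ends_seq _ (fun s' => nmem s' "ok" [::] = 1 /\ nmem s' "strict" [::] = 0)
  2 (2 + m * 50)) => //.
move=> s2 u2 [s2ok s2st].
apply: (@ends_for _ m 49 (fun j s' =>
  nmem s' "ok" [::] = all (fun i =>
    coordinate th a i <= coordinate th u i <= coordinate th b i)%R (iota 0 j) /\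
  nmem s' "strict" [::] = has (fun i =>
    coordinate th u i != coordinate th b i)%R (iota 0 j))) => //.
move=> i s3 im u3 s3i [s3ok s3st]; rewrite all_iota_rcons has_iota_rcons.
have e3 c x : nmem s x [::] = c -> c < M -> 
    ~~ nwrites (compare_vectors m) x ->
    nmem s3 x [::] = c /\ rmem s3 "vec" [:: c; i] = (coordinate th c i)%:E.
  move=> sx cM; rewrite /= !negb_or => /and5P[x1 x2 x3 x4 x5].
  rewrite (u3.2 "vec" isT) (u2.2 "vec" isT) (u1.2 "vec" isT) (env_vec se)//.
  by rewrite u3.1 ?u2.1 ?u1.1 //=; rewrite !negb_or x3 x4.
have [s3a va] := e3 a "a" sa aM isT.
have [s3b vb] := e3 b "b" sb bM isT.
have [s3u vu] := e3 u "u" su uM isT.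
apply: (@ends_seq _ (fun s' => nmem s' "ok" [::] =
    all (fun i =>
      coordinate th a i <= coordinate th u i <= coordinate th b i)%R (iota 0 i)
    && (coordinate th a i <= coordinate th u i <= coordinate th b i)%R /\
    nmem s' "strict" [::] = has (fun i => coordinate th u i != coordinate th b i) (iota 0 i))
  24 25) => //.
- apply: (@ends_if _ 3) => //=; rewrite s3a s3b s3u s3i va vb vu !lee_fin.
  + by move=> ->; rewrite andbT; exact: ends_skip.
  + by move=> /negbTE ->; rewrite andbF; exact: ends_nset.
- move=> s4 u4 [s4ok s4st].
  apply: (@ends_if _ 3) => //=; rewrite (u4.2 "vec" isT) (u4.1 "b" isT)
    (u4.1 "u" isT) (u4.1 "i" isT) s3b s3u s3i vb vu !lee_fin -eq_le.
  + by move=> ->; rewrite orbF; exact: ends_skip.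
  + by move=> /negbTE ->; rewrite orbT; exact: ends_nset.
Qed.

End Tables.

(** * Filling the table *)

Section Fill.
Context (R : realType) (n : nat) (I : instance R n) (m : nat).
Hypotheses (n_gt0 : 0 < n) (m_gt0 : 0 < m).
Implicit Types (s : store R) (k a b u w h q : nat).

Let th := theta_seq I.
Let lam := lambda_seq I.
Let M := size th ^ m.
Let L := size lam.
Let W := total_weight I.
Local Notation V := (@vector_of_code R n I m).

(** The time 0 is an arbitrary representative: one value serves all pairs (h, q). *)
Definition table_value k a b w : \bar R := dpE I k (V a) (V b) w 0%R.

Definition filled s k a b w h q : Prop :=
  rmem s "E" [:: k; a; b; w; h; q] = table_value k a b w.

Definition grows s s' : Prop :=
  forall k a b w h q, filled s k a b w h q -> filled s' k a b w h q.

Definition level_filled s k : Prop :=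
  forall a b w h q, a < M -> b < M -> w < W.+1 -> h < m -> q < L.+1 ->
  filled s k a b w h q.

Lemma grows_trans s1 s2 s3 : grows s1 s2 -> grows s2 s3 -> grows s1 s3.
Proof. by move=> g12 g23 k a b w h q /g12/g23. Qed.

(** Stability of Q under [grows] makes the achievement of one iteration persist while later ones
    write to the same table. *)
Lemma ends_for_grows K T1 (Q : nat -> store R -> Prop) i e c s T :
  neval s e = K ->
  (forall j s1 s2, grows s1 s2 -> Q j s1 -> Q j s2) ->
  (forall j s', j < K -> unchanged (For i e c) s s' -> nmem s' i [::] = j ->
     grows s s' -> ends c s' T1 (fun s'' => grows s' s'' /\ Q j s'')) ->
  (ncost e).+1 + K * T1.+1 <= T ->
  ends (For i e c) s T (fun s' => grows s s' /\ forall j, j < K -> Q j s').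
Proof.
move=> eK Qg cQ leT.
apply: (@ends_for _ K T1 (fun j s' => grows s s' /\ forall j', j' < j -> Q j' s')) => //.
- by split=> // ? ? ? ? ? ?.
- move=> j s' [g q]; split=> // j' /q; exact: Qg.
- move=> j s' jK u sj [g q]; apply: ends_conseq (cQ j s' jK u sj g) (leqnn _) _.
  move=> s'' _ [g' q']; split; first exact: grows_trans g g'.
  by move=> j'; rewrite ltnS leq_eqVlt => /orP[/eqP -> //|/q]; exact: Qg.
Qed.

Record at_state s k a b w h q : Prop := AtState {
  at_env : env I m s;
  at_k : nmem s "k" [::] = k;
  at_a : nmem s "a" [::] = a;
  at_b : nmem s "b" [::] = b;
  at_w : nmem s "wgt" [::] = w;
  at_h : nmem s "h" [::] = h;
  at_s : nmem s "s" [::] = q }.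

Definition state_safe (c : com) : bool :=
  env_safe c && all (fun x => ~~ nwrites c x) [:: "k"; "a"; "b"; "wgt"; "h"; "s"].

Lemma at_state_unchanged c s s' k a b w h q :
  unchanged c s s' -> at_state s k a b w h q -> state_safe c ->
  at_state s' k a b w h q.
Proof.
move=> u [e ek ea eb ew eh es] /andP[ce /= /and5P[c1 c2 c3 c4 /and3P[c5 c6 _]]].
by split; rewrite ?u.1//; exact: env_unchanged ce u e.
Qed.

(** Here k is the content of the program variable and K the layer being written: K = 0 for the
    initial layer, k + 1 afterwards. *)
Lemma for_states_ends c s k K T1 :
  env I m s -> state_safe c -> nmem s "k" [::] = k ->
  (forall a b w h q s', a < M -> b < M -> w < W.+1 -> h < m -> q < L.+1 ->
     at_state s' k a b w h q -> grows s s' ->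
     ends c s' T1 (fun s'' => grows s' s'' /\ filled s'' K a b w h q)) ->
  ends (for_states m c) s
    ((T1 + 20) * (M * (M * (W.+1 * (m * L.+1)))))
    (fun s' => grows s s' /\ level_filled s' K).
Proof.
move=> se /andP[ce /= /and5P[ck ca cb cw /and3P[ch cs _]]] sk body.
have M0 : 0 < M := M_gt0 _ _ n_gt0.
pose P1 := L.+1; pose P2 := m * P1; pose P3 := W.+1 * P2; pose P4 := M * P3.
have P10 : 0 < P1 by [].
have P20 : 0 < P2 by rewrite muln_gt0 m_gt0.
have P30 : 0 < P3 by rewrite muln_gt0.
have P40 : 0 < P4 by rewrite muln_gt0 M0.
(* Each of the five loops costs only a small additive constant in the coefficient; together they
   account for the 20 in the statement. *)
have bound A K' T2 T3 P : 0 < K' -> 0 < P -> T2 + A + 1 <= T3 ->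
    A + K' * (T2 * P).+1 <= T3 * (K' * P).
  move=> K0 P0 T23; apply: leq_trans (loop_time A T2 (leqnn K') K0 P0) _.
  by rewrite leq_mul2r T23 orbT.
apply: (@ends_conseq _ _ _ _ _ (fun s' => grows s s' /\ forall a, a < M ->
    forall b, b < M -> forall w, w < W.+1 -> forall h, h < m ->
    forall q, q < L.+1 -> filled s' K a b w h q)); last 2 first.
- exact: leqnn.
- by move=> s1 _ [g f]; split=> // a b w h q aM bM wW hm qL; apply: f.
apply: (@ends_for_grows M ((T1 + 17) * P4)) => /=.
- exact: env_M se.
- by move=> a s1 s2 g h b bM w wW hh hm q qL; apply/g/h.
- move=> a s1 aM u1 s1a g1.
  have e1 : env I m s1 by apply: env_unchanged u1 se.
  apply: (@ends_for_grows M ((T1 + 14) * P3)) => /=.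
  + exact: env_M e1.
  + by move=> b s2 s3 g h w wW hh hm q qL; apply/g/h.
  + move=> b s2 bM u2 s2b g2.
    have e2 : env I m s2 by apply: env_unchanged u2 e1.
    apply: (@ends_for_grows W.+1 ((T1 + 9) * P2)) => /=.
    * by rewrite (env_W e2) addn1.
    * by move=> w s3 s4 g h hh hm q qL; apply/g/h.
    * move=> w s3 wW u3 s3w g3.
      have e3 : env I m s3 by apply: env_unchanged u3 e2.
      apply: (@ends_for_grows m ((T1 + 6) * P1)) => //=.
      - by move=> h s4 s5 g hh q qL; apply/g/hh.
      - move=> h s4 hm u4 s4h g4.
        have e4 : env I m s4 by apply: env_unchanged u4 e3.
        apply: (@ends_for_grows L.+1 T1) => /=.
        + by rewrite (env_L e4) addn1.
        + by move=> q s5 s6 g; apply: g.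
        + move=> q s5 qL u5 s5q g5.
          have e5 : env I m s5 by apply: env_unchanged u5 e4.
          apply: body => //.
            split=> //.
            - by rewrite (u5.1 "k") ?(u4.1 "k") ?(u3.1 "k") ?(u2.1 "k") ?(u1.1 "k").
            - by rewrite (u5.1 "a") ?(u4.1 "a") ?(u3.1 "a") ?(u2.1 "a").
            - by rewrite (u5.1 "b") ?(u4.1 "b") ?(u3.1 "b").
            - by rewrite (u5.1 "wgt") ?(u4.1 "wgt").
            - by rewrite (u5.1 "h").
          by do 4 (apply: grows_trans; first eassumption); eassumption.
        + by rewrite /P1; nia.
      - by apply: bound => //; lia.
    * by apply: bound => //; lia.
  + by apply: bound => //; lia.
- by apply: bound => //; lia.
Qed.

Lemma fill_first_ends s : env I m s ->
  ends (fill_first m) s (50 * (M * (M * (W.+1 * (m * L.+1)))))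
    (fun s' => level_filled s' 0).
Proof.
move=> se.
apply: (@ends_conseq _ _ _ ((30 + 20) * (M * (M * (W.+1 * (m * L.+1))))) _
  (fun s' => grows s s' /\ level_filled s' 0)) => //; last by move=> ? _ [].
apply: (for_states_ends se _ erefl) => // a b w h q s1 aM bM wW hm qL s1s g.
have inv v : v = table_value 0 a b w ->
    let s2 := rput s1 "E" [:: 0; a; b; w; h; q] v in
    grows s1 s2 /\ filled s2 0 a b w h q.
  move=> -> /=; split; last by rewrite /filled /= upd_same eqxx.
  move=> k' a' b' w' h' q'; rewrite /filled /= upd_same.
  (* If the write hits a cell that was already correct, the new value is again the right one. *)
  by case: eqP => // -[-> -> -> -> _ _].
apply: (@ends_if _ 20) => //=; rewrite (at_w s1s) => w0; apply: ends_rset => //=;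
  rewrite (at_a s1s) (at_b s1s) (at_w s1s) (at_h s1s) (at_s s1s); apply: inv.
- by rewrite /table_value /= w0.
- by rewrite /table_value /= (negbTE w0).
Qed.

(* "best" becomes the minimum of its former value and the elements of A. *)
Definition lowers s s' (A : \bar R -> Prop) : Prop :=
  forall y : \bar R, (y <= rmem s' "best" [::])%E <->
    (y <= rmem s "best" [::])%E /\ forall x, A x -> (y <= x)%E.

(** Lower bounds of a union are the common lower bounds of its members, so iterations compose
    without any infimum, and an empty set of candidates needs no special case. *)
Lemma ends_for_lowers K T1 (A : nat -> \bar R -> Prop) i e c s T :
  neval s e = K ->
  (forall j s', j < K -> unchanged (For i e c) s s' -> nmem s' i [::] = j ->
     ends c s' T1 (fun s'' => lowers s' s'' (A j))) ->
  (ncost e).+1 + K * T1.+1 <= T ->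
  ends (For i e c) s T (fun s' => lowers s s' (fun x => exists2 j, j < K & A j x)).
Proof.
move=> eK cA leT.
apply: (@ends_for _ K T1 (fun j s' =>
  lowers s s' (fun x => exists2 j', j' < j & A j' x))) => //.
- by move=> y; split=> [h|[]//]; split=> // x [].
- move=> j s1 jK u sj inv; apply: ends_conseq (cA j s1 jK u sj) (leqnn _) _.
  move=> s2 _ low y; rewrite low inv; split.
    move=> [[h1 h2] h3]; split=> // x [j']; rewrite ltnS leq_eqVlt.
    by case/orP=> [/eqP ->|j'j Ax]; [exact: h3|apply: h2; exists j'].
  move=> [h1 h2]; split; [split=> // x [j' j'j Ax]|move=> x Ax]; apply: h2.
    by exists j' => //; apply: ltnW.
  by exists j.
Qed.

Lemma lowers_same s s' (A : \bar R -> Prop) :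
  rmem s' "best" [::] = rmem s "best" [::] -> (forall x, ~ A x) -> lowers s s' A.
Proof.
by move=> e nA y; rewrite e; split=> [h|[]//]; split=> // x /nA.
Qed.

(** * The candidates of E' and the minimisation loops *)

Definition job_start u h : R := coordinate th u h.
Definition job_end u h q : R := (job_start u h + volume I / nth 0 lam q)%R.

Definition admissible k u h q : bool :=
  (Defs.rel I k <= job_start u h)%R && (job_start u h < job_end u h q <= dl I k)%R.

Definition candidate k a b u w w' h q : \bar R :=
  (table_value k a u w'
   + (volume I `^ alpha I / (job_end u h q - job_start u h) `^ (alpha I - 1))%R%:E
   + table_value k u b (w - w' - wt I k)%N)%E.

(** The quantifiers are nested exactly as the loops, so that [ends_for_lowers] peels them off one at
    a time. With truncated subtraction the range of w' is empty when the job weighs more than w. *)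
Definition candidates k a b w (x : \bar R) : Prop :=
  exists2 u, u < M & (between I m a u b && differ I m u b) /\
  exists2 q, q < L & exists2 h, h < m & admissible k u h q /\
  exists2 w', w' < w + 1 - wt I k & x = candidate k a b u w w' h q.

(** Real choices and indices correspond: every u over Theta has a code and every s in Lambda a
    position, while conversely codes and positions denote admissible u and s. *)
Lemma candidatesP k a b w (y : \bar R) :
  (y <= table_value k.+1 a b w)%E <->
  (y <= table_value k a b w)%E /\ forall x, candidates k a b w x -> (y <= x)%E.
Proof.
rewrite {1}/table_value /= le_min; split.
  move=> /andP[-> /ereal_infP h]; split=> //.
  move=> x [u uM [/betweenP[au ub] [q qL [h' h'm [/andP[ad1 ad2] [w' w'w ->]]]]]].
  apply: h; exists (V u), (nth 0%R lam q), (Ordinal h'm), w'; rewrite mxE.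
  split=> //; first by split; [exact: vector_of_code_Theta|apply/mem_lambda_seq/mem_nth].
    lia.
  by congr (_ + _ + _)%E; exact: dpE_time_irrelevant.
move=> [-> h]; apply/ereal_infP => x [v [l [h' [w' /=]]]].
move=> [[/vector_of_code_surj[u uM <-] /mem_lambda_seq ll] vv].
rewrite mxE => ad ww ->; apply: h; exists u => //; split; first exact/betweenP.
exists (index l lam); first by rewrite index_mem.
exists h' => //; rewrite /admissible /job_end nth_index//; split.
  by apply/andP; split; apply ad.
exists w'; first by lia.
rewrite /candidate /job_end nth_index//.
by congr (_ + _ + _)%E; exact: dpE_time_irrelevant.
Qed.

Lemma level_filled_grows s s' k : grows s s' -> level_filled s k -> level_filled s' k.
Proof. by move=> g f a b w h q *; apply/g/f. Qed.

Lemma level_filled_eq s s' k :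
  rmem s' "E" = rmem s "E" -> level_filled s k -> level_filled s' k.
Proof. by move=> e f a b w h q *; rewrite /filled e; apply: f. Qed.

(** The time for one cell: at most 350 steps for each of the combinations of u, s', h' and w'.
    Lambda may be empty, and [L.+1] keeps the product positive even then. *)
Definition next_bound : nat := 350 * (M * (L.+1 * (m * W.+1))).

Lemma fill_next_ends s k : env I m s -> nmem s "k" [::] = k ->
  level_filled s k ->
  ends (fill_next m) s ((next_bound + 20) * (M * (M * (W.+1 * (m * L.+1)))))
    (fun s' => grows s s' /\ level_filled s' k.+1).
Proof.
move=> se sk sf; rewrite /fill_next; cbv zeta.
have M0 : 0 < M := M_gt0 _ _ n_gt0.
apply: (for_states_ends se _ sk) => // a b w h q s0 aM bM wW hm qL s0s g0.
have {sf} s0f : level_filled s0 k by apply: level_filled_grows sf.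
apply: (@ends_seq _ (fun s' => rmem s' "best" [::] = table_value k a b w) 10
  (320 * (M * (L.+1 * (m * W.+1))) + 20)); last first.
- have : 0 < M * (L.+1 * (m * W.+1)) by rewrite !muln_gt0 M0 m_gt0.
  by rewrite /next_bound; lia.
- move=> s1 u1 s1best; have s1s := at_state_unchanged u1 s0s isT.
  have s1f : level_filled s1 k by apply: level_filled_eq s0f; rewrite (u1.2 "E" isT).
  apply: (@ends_seq _ (fun s' => lowers s1 s' (candidates k a b w))
    (303 * (M * (L.+1 * (m * W.+1)))) 15); last first.
  + have : 0 < M * (L.+1 * (m * W.+1)) by rewrite !muln_gt0 M0 m_gt0.
    by lia.
  + move=> s2 u2 low; have s2s := at_state_unchanged u2 s1s isT.
    (* Both sides have the same lower bounds, by [low] and [candidatesP]. *)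
    have s2best : rmem s2 "best" [::] = table_value k.+1 a b w.
      apply/le_anti/andP; split.
        by apply/candidatesP; rewrite -s1best; apply/low.
      by apply/low; rewrite s1best; apply/candidatesP.
    apply: ends_rset => //=; rewrite s2best (at_k s2s) (at_a s2s) (at_b s2s).
    rewrite (at_w s2s) (at_h s2s) (at_s s2s) addn1.
    split; last by rewrite /filled /= upd_same eqxx.
    move=> k' a' b' w' h' q'; rewrite /filled /= upd_same.
    case: eqP => [[-> -> -> -> _ _] //|_].
    by rewrite (u2.2 "E" isT) (u1.2 "E" isT).
  apply: (@ends_for_lowers M (300 * (L.+1 * (m * W.+1)))) => /=; last 1 first.
  + apply: leq_trans (loop_time 2 300 (leqnn M) M0 _) _ => //.
    by rewrite !muln_gt0 m_gt0.
  + exact: env_M (at_env s1s).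
  move=> u s2 uM u2 s2u.
  have s2s := at_state_unchanged u2 s1s isT.
  have s2f : level_filled s2 k by apply: level_filled_eq s1f; rewrite (u2.2 "E" isT).
  apply: (@ends_seq _ _ (6 + m * 50) (180 * (L.+1 * (m * W.+1)))).
  + exact: compare_vectors_ends (at_env s2s) (at_a s2s) (at_b s2s) s2u aM bM uM.
  + move=> s3 u3 [s3ok s3st].
    have s3s := at_state_unchanged u3 s2s isT.
    have s3u : nmem s3 "u" [::] = u by rewrite (u3.1 "u" isT).
    have s3f : level_filled s3 k by apply: level_filled_eq s2f; rewrite (u3.2 "E" isT).
    have best32 : rmem s3 "best" [::] = rmem s2 "best" [::] by rewrite (u3.2 "best" isT).
    pose A x := exists2 q, q < L & exists2 h, h < m & admissible k u h q /\
      exists2 w', w' < w + 1 - wt I k & x = candidate k a b u w w' h q.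
    apply: (@ends_if _ (156 * (L.+1 * (m * W.+1)))) => /=.
    * rewrite s3ok s3st !eqb1 => ubd.
      apply: (@ends_conseq _ _ _ _ _ (fun s' => lowers s3 s' A)); last 2 first.
      - exact: leqnn.
      (* Once u has passed the comparison, its candidates are exactly the elements of A. *)
      - move=> s4 _ low y; rewrite low best32; split=> -[h1 h2]; split=> // x.
          by move=> [_ Ax]; exact: h2.
        by move=> Ax; apply: h2.
      apply: (@ends_for_lowers L (153 * (m * W.+1))) => /=; last 1 first.
      - apply: leq_trans (loop_time 2 153 (leqnSn L) _ _) _ => //.
        by rewrite !muln_gt0 m_gt0.
      - exact: env_L (at_env s3s).
      move=> q' s4 q'L u4 s4q.
      have s4s := at_state_unchanged u4 s3s isT.
      have s4f : level_filled s4 k by apply: level_filled_eq s3f; rewrite (u4.2 "E" isT).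
      have s4u : nmem s4 "u" [::] = u by rewrite (u4.1 "u" isT).
      apply: (@ends_for_lowers m (150 * W.+1)) => //=; last 1 first.
      - by apply: leq_trans (loop_time 2 150 (leqnn m) _ _) _.
      move=> h' s5 h'm u5 s5h.
      have s5s := at_state_unchanged u5 s4s isT.
      have s5f : level_filled s5 k by apply: level_filled_eq s4f; rewrite (u5.2 "E" isT).
      have s5u : nmem s5 "u" [::] = u by rewrite (u5.1 "u" isT).
      have s5q : nmem s5 "s'" [::] = q' by rewrite (u5.1 "s'" isT).
      apply: (@ends_seq _ (fun s' => rmem s' "e'" [::] = (job_end u h' q')%:E) 10
        (140 * W.+1)); last by lia.
        apply: ends_rset => //=; rewrite upd_same /= s5u s5h s5q.
        rewrite (env_vec (at_env s5s))// (env_p (at_env s5s)).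
        by rewrite (env_lambda (at_env s5s)).
      move=> s6 u6 s6e.
      have s6s := at_state_unchanged u6 s5s isT.
      have s6f : level_filled s6 k by apply: level_filled_eq s5f; rewrite (u6.2 "E" isT).
      have s6u : nmem s6 "u" [::] = u by rewrite (u6.1 "u" isT).
      have s6q : nmem s6 "s'" [::] = q' by rewrite (u6.1 "s'" isT).
      have s6h : nmem s6 "h'" [::] = h' by rewrite (u6.1 "h'" isT).
      have best65 : rmem s6 "best" [::] = rmem s5 "best" [::] by rewrite (u6.2 "best" isT).
      have s6v : rmem s6 "vec" [:: u; h'] = (job_start u h')%:E.
        by rewrite (env_vec (at_env s6s)).
      have test : (rmem s6 "r" [:: nmem s6 "k" [::]] <=
            rmem s6 "vec" [:: nmem s6 "u" [::]; nmem s6 "h'" [::]])%E &&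
          ((rmem s6 "vec" [:: nmem s6 "u" [::]; nmem s6 "h'" [::]] <
            rmem s6 "e'" [::])%E &&
          (rmem s6 "e'" [::] <= rmem s6 "d" [:: nmem s6 "k" [::]])%E) =
          admissible k u h' q'.
        rewrite s6u s6h s6v s6e (at_k s6s) (env_r (at_env s6s)) (env_d (at_env s6s)).
        by rewrite !lee_fin lte_fin.
      apply: (@ends_if _ (108 * W.+1)) => /=; rewrite ?test.
      - move=> ad.
        apply: (@ends_conseq _ _ _ _ _ (fun s' => lowers s6 s' (fun x =>
          exists2 w', w' < w + 1 - wt I k & x = candidate k a b u w w' h' q')));
          last 2 first.
        + exact: leqnn.
        + move=> s7 _ low y; rewrite low best65; split=> -[h1 h2]; split=> // x.
            by move=> [_ Ax]; exact: h2.
          by move=> Ax; apply: h2.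
        apply: (@ends_for_lowers (w + 1 - wt I k) 100) => /=; last 1 first.
        + have := @loop_time 7 (w + 1 - wt I k) W.+1 100 1; rewrite !muln1.
          by apply=> //; lia.
        + by rewrite (at_w s6s) (at_k s6s) (env_w (at_env s6s)).
        move=> w' s7 w'w u7 s7w.
        have s7s := at_state_unchanged u7 s6s isT.
        have s7f : level_filled s7 k by apply: level_filled_eq s6f; rewrite (u7.2 "E" isT).
        have s7u : nmem s7 "u" [::] = u by rewrite (u7.1 "u" isT).
        have s7q : nmem s7 "s'" [::] = q' by rewrite (u7.1 "s'" isT).
        have s7h : nmem s7 "h'" [::] = h' by rewrite (u7.1 "h'" isT).
        have s7e : rmem s7 "e'" [::] = (job_end u h' q')%:E by rewrite (u7.2 "e'" isT).
        have s7v : rmem s7 "vec" [:: u; h'] = (job_start u h')%:E.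
          by rewrite (env_vec (at_env s7s)).
        apply: (@ends_seq _ (fun s' => rmem s' "cand" [::] =
          candidate k a b u w w' h' q') 60 30) => //.
          apply: ends_rset => //=; rewrite upd_same /= s7u s7h s7q s7w s7v s7e.
          rewrite (at_k s7s) (at_a s7s) (at_b s7s) (at_w s7s) (at_h s7s) (at_s s7s).
          rewrite (env_w (at_env s7s)) (env_p (at_env s7s)) (env_alpha (at_env s7s)).
          (* Both lookups fall into the complete layer k: one at (h, q) for e relative to a, the
             other at (h', q') for e' relative to u. What remains is that the two weights are at
             most W. *)
          by rewrite !s7f//; lia.
        move=> s8 u8 s8c.
        have best87 : rmem s8 "best" [::] = rmem s7 "best" [::] by rewrite (u8.2 "best" isT).
        apply: (@ends_if _ 3) => //=; rewrite s8c best87.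
        + move=> lt; apply: ends_rset => // y /=; rewrite upd_same /= s8c.
          split=> [h1|[_]]; last by apply.
          by split=> [|x -> //]; apply: le_trans h1 (ltW lt).
        + rewrite -leNgt => le; apply: ends_skip => // y; rewrite best87.
          by split=> [h1|[]//]; split=> // x ->; apply: le_trans h1 le.
      - move=> /negbTE nad; apply: ends_skip; first by rewrite muln_gt0.
        by apply: lowers_same => // x []; rewrite nad.
      - by lia.
    * rewrite s3ok s3st !eqb1 => /negbTE nb.
      apply: ends_skip; first by rewrite !muln_gt0 m_gt0.
      by apply: lowers_same => // x []; rewrite nb.
    * have : 0 < L.+1 * (m * W.+1) by rewrite !muln_gt0 m_gt0.
      by lia.
  (* The comparison of vectors costs 6 + 50m, absorbed because the product contains the factor m. *)
  + have h1 : m <= L.+1 * (m * W.+1) by rewrite mulnCA leq_pmulr// muln_gt0.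
    have h2 : 0 < L.+1 * (m * W.+1) by rewrite !muln_gt0 m_gt0.
    by lia.
- apply: ends_rset => //=; rewrite upd_same /=.
  rewrite (at_k s0s) (at_a s0s) (at_b s0s) (at_w s0s) (at_h s0s) (at_s s0s).
  exact: s0f.
Qed.

End Fill.

(** * The whole program *)

(** Traces a memory access back through the chain of [unchanged] hypotheses to the state where its
    content was established. *)
Ltac frame := repeat match goal with
  | u : unchanged _ _ ?s' |- context [nmem ?s' ?x] => rewrite (proj1 u x isT)
  | u : unchanged _ _ ?s' |- context [rmem ?s' ?x] => rewrite (proj2 u x isT)
  end.

Section Main.
Context (R : realType) (n : nat) (I : instance R n) (m : nat).
Hypotheses (n_gt0 : 0 < n) (m_gt0 : 0 < m).
Implicit Types (s : store R).

Let th := theta_seq I.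
Let lam := lambda_seq I.
Let M := size th ^ m.
Let L := size lam.
Let W := total_weight I.
Local Notation V := (@vector_of_code R n I m).

Definition affordable (ca cb w : nat) : bool :=
  (table_value I m n ca cb w <= (budget I)%:E)%E.

Lemma select_answer_ends s ca cb :
  (0 <= budget I)%R ->
  env I m s -> level_filled I m s n ->
  nmem s "start" [::] = ca -> nmem s "end" [::] = cb -> ca < M -> cb < M ->
  rmem s "budget" [::] = (budget I)%:E ->
  ends select_answer s (40 * W.+1) (fun s' =>
    [/\ affordable ca cb (answer s'), answer s' <= W &
        forall w, w <= W -> affordable ca cb w -> w <= answer s']).
Proof.
move=> budget_ge0 se sf sa sb caM cbM sbu.
pose best j s' := [/\ affordable ca cb (answer s'), answer s' < j &
        forall w, w < j -> affordable ca cb w -> w <= answer s'].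
(* Nothing is assumed about the initial answer; the invariant starts after weight 0, which is always
   affordable. As weights are scanned upwards, the last affordable one is the largest. *)
apply: (@ends_for _ W.+1 30 (fun j s' => 0 < j -> best j s')) => //=.
- by rewrite (env_W se) addn1.
- move=> j s1 jW u1 s1j inv.
  have e1 : env I m s1 by apply: env_unchanged u1 se.
  apply: (@ends_if _ 3) => //=; rewrite s1j (env_n e1) (env_L e1);
    rewrite (u1.1 "start" isT) (u1.1 "end" isT) sa sb (u1.2 "budget" isT) sbu;
    rewrite (u1.2 "E" isT) sf // -/(affordable ca cb j) => afj.
  + by apply: ends_nset; rewrite //= /best /answer /= upd_same /= s1j; split.
  + case: j {jW u1 s1j} afj inv => [|j] afj inv.
      by case/negP: afj; apply: le_trans (dpE_weight0 _ _ _ _ _) _; rewrite lee_fin.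
    have [//|b1 b2 b3] := inv.
    apply: ends_skip => //; split=> //; first exact: ltnW.
    move=> w; rewrite ltnS leq_eqVlt => /orP[/eqP -> h|]; last exact: b3.
    by rewrite h in afj.
- by lia.
- by move=> s1 _ [].
Qed.

Definition initialised s : Prop :=
  [/\ array s "shift" (rcons [seq (volume I / x)%R | x <- lam] 0%R),
      nmem s "start" [::] < M /\ V (nmem s "start" [::]) = const_mx (rmin I),
      nmem s "end" [::] < M /\ V (nmem s "end" [::]) = const_mx (dlast I)
    & rmem s "budget" [::] = (budget I)%:E].

(** Stated for an arbitrary continuation c, since [dp] is a sequence nested to the right. *)
Lemma setup_ends T Q c :
  (forall s, env I m s -> initialised s -> ends c s T Q) ->
  ends (Seq compute_Omega (Seq compute_Theta (Seq compute_Lambda (Seq compute_shift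
  (Seq (compute_vectors m) (Seq compute_weight (Seq compute_rmin
  (Seq (find_constant m "start" (RGet "rmin" [::]))
  (Seq (find_constant m "end" (RGet "d" [:: NSub (NGet "n" [::]) (NConst 1)]))
       c)))))))))
    (load I) (700 * n ^ 4 + 300 * (m + 1) * M + 12 * L.+1 + T) Q.
Proof.
move=> cQ; set s0 := load I.
have M0 : 0 < M := M_gt0 _ _ n_gt0.
have p1 : n <= n ^ 4 by rewrite -[X in X <= _]expn1 leq_pexp2l.
have p3 : n ^ 3 <= n ^ 4 by rewrite leq_pexp2l.
have M1 : m + 1 <= (m + 1) * M by rewrite leq_pmulr.
(* The stated total acts as an allowance: each phase takes its share and passes the remainder on to
   the next. *)
apply: (@ends_seq _ _ (22 * n)
  (678 * n ^ 4 + 300 * (m + 1) * M + 12 * L.+1 + T)); last by lia.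
  exact: compute_Omega_ends.
move=> s1 u1 s1O.
apply: (@ends_seq _ _ (400 * n ^ 4)
  (278 * n ^ 4 + 300 * (m + 1) * M + 12 * L.+1 + T)); last by lia.
  by apply: compute_Theta_ends s1O => //; frame.
move=> s2 u2 s2T.
apply: (@ends_seq _ _ (200 * n ^ 3)
  (78 * n ^ 4 + 300 * (m + 1) * M + 12 * L.+1 + T)); last by lia.
  by apply: compute_Lambda_ends => // [|j jO|]; frame => //; exact: s1O.
move=> s3 u3 s3L.
apply: (@ends_seq _ _ (12 * L.+1)
  (78 * n ^ 4 + 300 * (m + 1) * M + T)); last by lia.
  by apply: compute_shift_ends => //; frame.
move=> s4 u4 s4s.
apply: (@ends_seq _ _ (30 * (m + 1) * (M + 1))
  (78 * n ^ 4 + 240 * (m + 1) * M + T)); last by nia.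
  by apply: (@compute_vectors_ends _ m s4 th); split=> [|j jT]; frame; apply s2T.
move=> s5 u5 [s5M s5v].
apply: (@ends_seq _ _ (12 * n)
  (66 * n ^ 4 + 240 * (m + 1) * M + T)); last by lia.
  by apply: compute_weight_ends => [||j]; frame.
move=> s6 u6 s6W.
apply: (@ends_seq _ _ (20 * n)
  (46 * n ^ 4 + 240 * (m + 1) * M + T)); last by lia.
  by apply: compute_rmin_ends => [||j]; frame.
move=> s7 u7 s7r.
have e7 : env I m s7.
  split=> [|||| j | j | j ||| j jL | c0 i cM im]; frame => //.
  - by case: s3L.
  - by case: s3L => _; apply.
  - exact: s5v.
apply: (@ends_seq _ _ ((20 + 2 * rcost (RGet "rmin" [::])) * (m + 1) * M * 3)
  (46 * n ^ 4 + 170 * (m + 1) * M + T)) => /=; last by lia.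
  apply: (@find_constant_ends _ _ _ _ _ _ _ _ (rmin I)) => // [i|s' u' /=]; last by frame.
  by rewrite mxE; apply: Omega_Theta => //; apply: Omega_rmin.
move=> s8 u8 s8s.
have e8 : env I m s8 by apply: env_unchanged u8 e7.
pose dn := RGet "d" [:: NSub (NGet "n" [::]) (NConst 1)].
apply: (@ends_seq _ _ ((20 + 2 * rcost dn) * (m + 1) * M * 3)
  (46 * n ^ 4 + T)) => /=; last by lia.
  apply: (@find_constant_ends _ _ _ _ _ _ _ _ (dlast I)) => // [i|s' u' /=].
    by rewrite mxE; apply: Omega_Theta => //; apply: Omega_dlast.
  by frame; rewrite /= subn1.
move=> s9 u9 s9e.
have e9 : env I m s9 by apply: env_unchanged u9 e8.
apply: (@ends_conseq _ _ _ T _ Q); [|by lia|by []].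
apply: cQ => //; split; frame => //.
by move=> j jL; frame; exact: s4s.
Qed.

Definition all_filled s : Prop := forall k, k <= n -> level_filled I m s k.

(** With nb and S as variables, the arithmetic never meets the large products they stand for. *)
Lemma fill_loop_time nb S : 0 < S ->
  2 + n * ((nb + 20) * S).+1 <= (nb + 50) * S * n.
Proof.
move=> S0; apply: leq_trans (loop_time 2 (nb + 20) (leqnn n) n_gt0 S0) _.
by rewrite -[leqRHS]mulnA [S * n]mulnC leq_mul2r -!addnA leq_add2l orbT.
Qed.

Lemma fill_time nb S : 50 * S + (nb + 50) * S * n <= (nb + 100) * S * n.
Proof.
have -> : nb + 100 = 50 + (nb + 50) by lia.
by rewrite [50 + _ in leqRHS]lock !mulnDl -lock !mulnDl leq_add2r leq_mul2l leq_pmulr.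
Qed.

Lemma fill_ends s : env I m s ->
  ends (Seq (fill_first m) (For "k" (NGet "n" [::]) (fill_next m))) s
    ((next_bound I m + 100) * (M * (M * (W.+1 * (m * L.+1)))) * n)
    all_filled.
Proof.
move=> se; set S := M * (M * (W.+1 * (m * L.+1))).
have S0 : 0 < S by rewrite !muln_gt0 m_gt0 M_gt0.
apply: (@ends_seq _ _ (50 * S) ((next_bound I m + 50) * S * n)).
- exact: fill_first_ends.
- move=> s1 u1 s1f; have e1 : env I m s1 by apply: env_unchanged u1 se.
  apply: (@ends_for _ n ((next_bound I m + 20) * S)
    (fun j s' => forall k, k <= j -> level_filled I m s' k)) => //.
  + exact: env_n e1.
  + by case.
  + move=> j s2 jn u2 s2j s2f.
    have e2 : env I m s2 by apply: env_unchanged u2 e1.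
    apply: ends_conseq (fill_next_ends _ _ e2 s2j (s2f _ (leqnn j))) (leqnn _) _ => //.
    move=> s3 _ [g s3f] k; rewrite leq_eqVlt => /orP[/eqP -> //|kj].
    exact: level_filled_grows g (s2f _ kj).
  + exact: fill_loop_time.
- exact: fill_time.
Qed.

Lemma dp_ends : (0 <= budget I)%R ->
  ends (dp m) (load I)
    (700 * n ^ 4 + 300 * (m + 1) * M + 12 * L.+1 +
     ((next_bound I m + 100) * (M * (M * (W.+1 * (m * L.+1)))) * n + 40 * W.+1))
    (fun st => tabulates I m st /\ is_best_weight I m (answer st)).
Proof.
move=> budget_ge0; rewrite /dp.
apply: setup_ends => s es [s_shift [saM sa] [sbM sb] s_budget].
(* Reassociation groups the initial layer with the loop over k, the shape treated by [fill_ends]. *)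
apply: ends_seqA; apply: ends_seq (fill_ends es) _ (leqnn _) => s1 u1 s1f.
have e1 : env I m s1 by apply: env_unchanged u1 es.
have := @select_answer_ends s1 _ _ budget_ge0 e1 (s1f n (leqnn n)) erefl erefl.
frame => /(_ saM sbM s_budget) select.
apply: ends_conseq select (leqnn _) _ => s2 u2 [best1 best2 best3].
split.
  move=> k a b w h x kn aT bT wW xv.
  have [ca caM Va] := vector_of_code_surj aT.
  have [cb cbM Vb] := vector_of_code_surj bT.
  (* The offset 0 sits at the extra index L, and p / s at the position of s in the list of
     Lambda. *)
  have [q qL qx] : exists2 q, q < L.+1 &
      nth 0%R (rcons [seq (volume I / x)%R | x <- lam] 0%R) q = x.
    case: xv => [->|[l /mem_lambda_seq ll ->]].
      by exists L => //; rewrite nth_rcons size_map ltnn eqxx.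
    have qL : index l lam < L by rewrite index_mem.
    exists (index l lam); first exact: ltnW.
    by rewrite nth_rcons size_map qL (nth_map 0%R)// nth_index.
  have vec_ofE c : c < M -> vec_of m s2 c = V c.
    move=> cM; apply/rowP => i; rewrite !mxE; frame.
    by rewrite (env_vec es cM (ltn_ord i)).
  exists ca, cb, q; split; rewrite ?vec_ofE//.
    by frame; rewrite s_shift ?qx// size_rcons size_map.
  frame; rewrite (s1f k kn ca cb w h q)// /table_value Va Vb.
  exact: dpE_time_irrelevant.
have affordableE w : affordable (nmem s "start" [::]) (nmem s "end" [::]) w =
    (dpE I n (const_mx (rmin I) : 'rV_m) (const_mx (dlast I)) w (rmin I)
      <= (budget I)%:E)%E.
  by rewrite /affordable /table_value sa sb; congr (_ <= _)%E; exact: dpE_time_irrelevant.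
split; first by split; rewrite -?affordableE.
by move=> w [wW]; rewrite -affordableE; exact: best3.
Qed.

End Main.


(** * Summing up the running time *)

Lemma weighted_sum_le c1 c2 c3 c4 c5 c6 m y B M l x w z :
  y <= B -> M <= z -> l <= z -> x <= m * z -> w <= z ->
  c1 * y + c2 * (m + 1) * M + c3 * l + (c4 * (m ^ 2 * z) + c5 * x + c6 * w) <=
  c1 * B + (c4 * m ^ 2 + c5 * m + c2 * (m + 1) + c3 + c6) * z.
Proof.
move=> yB Mz lz xz wz.
have h1 := leq_mul (leqnn c1) yB; have h2 := leq_mul (leqnn (c2 * (m + 1))) Mz.
have h3 := leq_mul (leqnn c3) lz; have h5 := leq_mul (leqnn c5) xz.
have h6 := leq_mul (leqnn c6) wz.
apply: leq_trans (leq_add (leq_add (leq_add h1 h2) h3)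
  (leq_add (leq_add (leqnn _) h5) h6)) _.
by apply: eq_leq; ring.
Qed.

(** Everything but the n^4 term of the setup is dominated by Z = M^3 (L + 1)^2 (W + 1)^2 n. From L +
    1 <= 5 n^3 and, as W > 0, W + 1 <= 2 W come the factor 100 = 5^2 * 2^2, and from N <= 8 n^4 the
    factor 8^(3m). *)
Lemma time_bound n m N L W : 0 < n -> 0 < m -> 0 < N -> 0 < W ->
  N <= 8 * n ^ 4 -> L <= 4 * n ^ 3 ->
  700 * n ^ 4 + 300 * (m + 1) * N ^ m + 12 * L.+1 +
  ((350 * (N ^ m * (L.+1 * (m * W.+1))) + 100) *
     (N ^ m * (N ^ m * (W.+1 * (m * L.+1)))) * n + 40 * W.+1) <=
  (700 + (350 * m ^ 2 + 100 * m + 300 * (m + 1) + 12 + 40) * (8 ^ (3 * m) * 100)) *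
    (n ^ (12 * m + 7) * W ^ 2).
Proof.
move=> n0 m0 N0 W0 N_le L_le.
set M := N ^ m; set B := n ^ _ * _.
have M0 : 0 < M by rewrite expn_gt0 N0.
(* Up to factors m, Y bounds the number of cells in the n layers filled by the main loop, and M (L +
   1) (W + 1) the number of candidates per cell. *)
pose Y := M * M * W.+1 * L.+1 * n; pose Z := Y * (M * L.+1 * W.+1).
have Y0 : 0 < Y by rewrite /Y !muln_gt0 M0 n0.
have Z_le : Z <= 8 ^ (3 * m) * 100 * B.
  have hM : M <= 8 ^ m * n ^ (4 * m).
    by rewrite expnM -expnMn leq_exp2r.
  have hL : L.+1 <= 5 * n ^ 3.
    have : 0 < n ^ 3 by rewrite expn_gt0 n0.
    by move: L_le; move: (n ^ 3) => x; lia.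
  have hW : W.+1 <= 2 * W by lia.
  apply: (@leq_trans ((8 ^ m * n ^ (4 * m)) ^ 3 * ((5 * n ^ 3) ^ 2 * ((2 * W) ^ 2 * n)))).
    have -> : Z = M ^ 3 * (L.+1 ^ 2 * (W.+1 ^ 2 * n)) by rewrite /Z /Y; ring.
    by rewrite !leq_mul// leq_exp2r.
  rewrite /B (expnMn (8 ^ m)) (expnMn 5) (expnMn 2) -!expnM.
  (* The three vectors a, b, u give 4m each, the two indices s and s' into the list of Lambda give 3
     each, and the layers give 1. *)
  have -> : 12 * m + 7 = 4 * m * 3 + 3 * 2 + 1 by lia.
  rewrite [3 * m]mulnC 2!expnD expn1.
  move: (8 ^ _) (n ^ (4 * m * 3)) (n ^ (3 * 2)) => x y z.
  by apply: eq_leq; ring.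
have n4 : n ^ 4 <= B.
  apply: (@leq_trans (n ^ (12 * m + 7))); first by rewrite leq_pexp2l//; lia.
  by rewrite leq_pmulr// expn_gt0 W0.
have hS : M * (M * (W.+1 * (m * L.+1))) * n <= m * Z.
  have -> : M * (M * (W.+1 * (m * L.+1))) * n = m * Y by rewrite /Y; ring.
  by rewrite leq_mul2l leq_pmulr ?orbT// !muln_gt0 M0.
have hQ : M * (L.+1 * (m * W.+1)) * (M * (M * (W.+1 * (m * L.+1))) * n) = m ^ 2 * Z.
  by rewrite /Z /Y; ring.
have h1 : M <= Z.
  have -> : Z = M * (Y * (L.+1 * W.+1)) by rewrite /Z; ring.
  by rewrite leq_pmulr// muln_gt0 Y0 muln_gt0.
have h2 : L.+1 <= Z.
  have -> : Z = L.+1 * (Y * (M * W.+1)) by rewrite /Z; ring.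
  by rewrite leq_pmulr// muln_gt0 Y0 muln_gt0 M0.
have h3 : W.+1 <= Z.
  have -> : Z = W.+1 * (Y * (M * L.+1)) by rewrite /Z; ring.
  by rewrite leq_pmulr// muln_gt0 Y0 muln_gt0 M0.
move: hS hQ; set S := M * (M * _); set P := M * (L.+1 * _) => hS hQ.
have -> c4 c5 : (c4 * P + c5) * S * n = c4 * (m ^ 2 * Z) + c5 * (S * n).
  by rewrite -hQ; ring.
apply: leq_trans (weighted_sum_le _ _ _ _ _ _ n4 h1 h2 hS h3) _.
by rewrite [leqRHS]mulnDl leq_add2l -mulnA leq_mul2l Z_le orbT.
Qed.

Theorem theorem3 (R : realType) (m : nat) (hm : (0 < m)%N) :
  exists C : nat, forall (n : nat) (I : instance R n), valid I ->
    let: (st, time) := run (dp m) (load I) in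
    [/\ tabulates I m st,
        is_best_weight I m (answer st)
      & (time <= C * (n ^ (12 * m + 7) * total_weight I ^ 2))%N].
Proof.
exists (700 + (350 * m ^ 2 + 100 * m + 300 * (m + 1) + 12 + 40) * (8 ^ (3 * m) * 100)).
move=> n I [[n_gt0 W_gt0] _ _ _ budget_ge0].
have [] := dp_ends n_gt0 hm budget_ge0.
case: (run _ _) => st time /= [tab best] t; split=> //; apply: leq_trans t _.
by apply: time_bound => //; [exact: size_theta_gt0|exact: size_theta_seq|exact: size_lambda_seq].
Qed.
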